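(* The word problem for any finitely generated free adequate semigroup or free adequate monoid is decidable. That is, for a finite set $\Sigma$, given two formal terms built from elements of $\Sigma$ using multiplication and the unary operations $+$ and $*$ (and, in the monoid case, the identity constant), it is algorithmically decidable whether they represent the same element of the free adequate semigroup (respectively monoid) on $\Sigma$.
   Context: For a semigroup $S$ let $S^1=S$ if $S$ is a monoid and otherwise $S$ with an identity adjoined. $a\,\mathcal{L}^*\,b$ iff for all $x,y\in S^1$: $ax=ay\Leftrightarrow bx=by$; $a\,\mathcal{R}^*\,b$ iff for all $x,y\in S^1$: $xa=ya\Leftrightarrow xb=yb$. $S$ is adequate if its idempotents commute and every $\mathcal{L}^*$-class and every $\mathcal{R}^*$-class contains an idempotent (necessarily unique); $x^+$ is the idempotent $\mathcal{R}^*$-related to $x$, $x^*$ the idempotent $\mathcal{L}^*$-related to $x$. Adequate semigroups [monoids] are viewed as $(2,1,1)$-algebras [$(2,1,1,0)$-algebras with the identity as constant], morphisms preserving all operations. The free adequate semigroup [monoid] on $\Sigma$ is an adequate semigroup [monoid] containing $\Sigma$ such that every map from $\Sigma$ to an adequate semigroup [monoid] extends uniquely to a morphism; ''finitely generated'' means $\Sigma$ is finite. *)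

(* Defs.v *)
From HB Require Import structures.
From mathcomp Require Import all_boot.
From Stdlib Require List.

Set Implicit Arguments.
Unset Strict Implicit.
Unset Printing Implicit Defensive.

(* Multiplication in S^1: None plays the role of the adjoined identity. *)
Definition mul1 (S : Type) (mul : S -> S -> S) (x : option S) (a : S) : S :=
  if x is Some x' then mul x' a else a.
Definition mulr1 (S : Type) (mul : S -> S -> S) (a : S) (x : option S) : S :=
  if x is Some x' then mul a x' else a.

Definition Lstar (S : Type) (mul : S -> S -> S) (a b : S) : Prop :=
  forall x y : option S, mulr1 mul a x = mulr1 mul a y <-> mulr1 mul b x = mulr1 mul b y.

Definition Rstar (S : Type) (mul : S -> S -> S) (a b : S) : Prop :=
  forall x y : option S, mul1 mul x a = mul1 mul y a <-> mul1 mul x b = mul1 mul y b.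

Definition idempotent_el (S : Type) (mul : S -> S -> S) (e : S) : Prop := mul e e = e.

Definition is_adequate (S : Type) (mul : S -> S -> S) (plus star : S -> S) : Prop :=
  [/\ (forall a b c, mul a (mul b c) = mul (mul a b) c),
      (forall e f, idempotent_el mul e -> idempotent_el mul f -> mul e f = mul f e),
      (forall a, idempotent_el mul (plus a) /\ Rstar mul a (plus a)) &
      (forall a, idempotent_el mul (star a) /\ Lstar mul a (star a))].

Definition is_adequate_monoid (S : Type) (mul : S -> S -> S) (plus star : S -> S)
    (one : S) : Prop :=
  is_adequate mul plus star /\ (forall a, mul one a = a /\ mul a one = a).

Definition is_ad_morphism (S T : Type) (mulS : S -> S -> S) (plusS starS : S -> S)
    (mulT : T -> T -> T) (plusT starT : T -> T) (h : S -> T) : Prop :=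
  [/\ (forall a b, h (mulS a b) = mulT (h a) (h b)),
      (forall a, h (plusS a) = plusT (h a)) &
      (forall a, h (starS a) = starT (h a))].

Definition is_free_adequate_semigroup (Sigma : Type) (F : Type)
    (mul : F -> F -> F) (plus star : F -> F) (iota : Sigma -> F) : Prop :=
  [/\ is_adequate mul plus star,
      injective iota &
      forall (S : Type) (mulS : S -> S -> S) (plusS starS : S -> S),
        is_adequate mulS plusS starS ->
        forall f : Sigma -> S,
          (exists h : F -> S, is_ad_morphism mul plus star mulS plusS starS h
                              /\ forall s, h (iota s) = f s) /\
          (forall h1 h2 : F -> S,
              is_ad_morphism mul plus star mulS plusS starS h1 ->
              is_ad_morphism mul plus star mulS plusS starS h2 ->
              (forall s, h1 (iota s) = f s) -> (forall s, h2 (iota s) = f s) ->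
              forall x, h1 x = h2 x)].

Definition is_free_adequate_monoid (Sigma : Type) (F : Type)
    (mul : F -> F -> F) (plus star : F -> F) (one : F) (iota : Sigma -> F) : Prop :=
  [/\ is_adequate_monoid mul plus star one,
      injective iota &
      forall (S : Type) (mulS : S -> S -> S) (plusS starS : S -> S) (oneS : S),
        is_adequate_monoid mulS plusS starS oneS ->
        forall f : Sigma -> S,
          (exists h : F -> S, is_ad_morphism mul plus star mulS plusS starS h
                              /\ h one = oneS /\ forall s, h (iota s) = f s) /\
          (forall h1 h2 : F -> S,
              is_ad_morphism mul plus star mulS plusS starS h1 -> h1 one = oneS ->
              is_ad_morphism mul plus star mulS plusS starS h2 -> h2 one = oneS ->
              (forall s, h1 (iota s) = f s) -> (forall s, h2 (iota s) = f s) ->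
              forall x, h1 x = h2 x)].

Inductive sterm (A : Type) : Type :=
| SVar of A
| SMul of sterm A & sterm A
| SPlus of sterm A
| SStar of sterm A.

Inductive mterm (A : Type) : Type :=
| MVar of A
| MOne
| MMul of mterm A & mterm A
| MPlus of mterm A
| MStar of mterm A.
Arguments MOne {A}.

Fixpoint seval (A F : Type) (mul : F -> F -> F) (plus star : F -> F)
    (iota : A -> F) (t : sterm A) : F :=
  match t with
  | SVar a => iota a
  | SMul t u => mul (seval mul plus star iota t) (seval mul plus star iota u)
  | SPlus t => plus (seval mul plus star iota t)
  | SStar t => star (seval mul plus star iota t)
  end.

Fixpoint meval (A F : Type) (mul : F -> F -> F) (plus star : F -> F) (one : F)
    (iota : A -> F) (t : mterm A) : F :=
  match t with
  | MVar a => iota a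
  | MOne => one
  | MMul t u => mul (meval mul plus star one iota t) (meval mul plus star one iota u)
  | MPlus t => plus (meval mul plus star one iota t)
  | MStar t => star (meval mul plus star one iota t)
  end.

Section Coding.
Variable A : countType.

Fixpoint sterm_to (t : sterm A) : GenTree.tree A :=
  match t with
  | SVar a => GenTree.Leaf a
  | SMul t u => GenTree.Node 0 [:: sterm_to t; sterm_to u]
  | SPlus t => GenTree.Node 1 [:: sterm_to t]
  | SStar t => GenTree.Node 2 [:: sterm_to t]
  end.

Fixpoint sterm_of (x : GenTree.tree A) : option (sterm A) :=
  match x with
  | GenTree.Leaf a => Some (SVar a)
  | GenTree.Node 0 [:: t; u] =>
      if sterm_of t is Some t' then
        if sterm_of u is Some u' then Some (SMul t' u') else None
      else None
  | GenTree.Node 1 [:: t] => omap (@SPlus A) (sterm_of t)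
  | GenTree.Node 2 [:: t] => omap (@SStar A) (sterm_of t)
  | _ => None
  end.

Lemma sterm_codeK : pcancel sterm_to sterm_of.
Proof. by elim=> [a|t IHt u IHu|t IHt|t IHt] //=; rewrite ?IHt ?IHu. Qed.

Fixpoint mterm_to (t : mterm A) : GenTree.tree A :=
  match t with
  | MVar a => GenTree.Leaf a
  | MOne => GenTree.Node 3 [::]
  | MMul t u => GenTree.Node 0 [:: mterm_to t; mterm_to u]
  | MPlus t => GenTree.Node 1 [:: mterm_to t]
  | MStar t => GenTree.Node 2 [:: mterm_to t]
  end.

Fixpoint mterm_of (x : GenTree.tree A) : option (mterm A) :=
  match x with
  | GenTree.Leaf a => Some (MVar a)
  | GenTree.Node 3 [::] => Some MOne
  | GenTree.Node 0 [:: t; u] =>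
      if mterm_of t is Some t' then
        if mterm_of u is Some u' then Some (MMul t' u') else None
      else None
  | GenTree.Node 1 [:: t] => omap (@MPlus A) (mterm_of t)
  | GenTree.Node 2 [:: t] => omap (@MStar A) (mterm_of t)
  | _ => None
  end.

Lemma mterm_codeK : pcancel mterm_to mterm_of.
Proof. by elim=> [a||t IHt u IHu|t IHt|t IHt] //=; rewrite ?IHt ?IHu. Qed.

End Coding.

HB.instance Definition _ (A : countType) := PCanIsCountable (@sterm_codeK A).
HB.instance Definition _ (A : countType) := PCanIsCountable (@mterm_codeK A).

Inductive recf : Type :=
| RZero
| RSucc
| RProj of nat
| RComp of recf & list recf
| RPrec of recf & recf
| RMu of recf.

Inductive recf_eval : recf -> seq nat -> nat -> Prop :=
| ev_zero v : recf_eval RZero v 0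
| ev_succ x v : recf_eval RSucc (x :: v) x.+1
| ev_proj i v : i < size v -> recf_eval (RProj i) v (nth 0 v i)
| ev_comp f gs v ys y :
    List.Forall2 (fun g y => recf_eval g v y) gs ys ->
    recf_eval f ys y -> recf_eval (RComp f gs) v y
| ev_prec0 f g v y : recf_eval f v y -> recf_eval (RPrec f g) (0 :: v) y
| ev_precS f g n v r y :
    recf_eval (RPrec f g) (n :: v) r -> recf_eval g (n :: r :: v) y ->
    recf_eval (RPrec f g) (n.+1 :: v) y
| ev_mu f v n :
    recf_eval f (n :: v) 0 ->
    (forall m, m < n -> exists k, recf_eval f (m :: v) k.+1) ->
    recf_eval (RMu f) v n.

Definition decidable_rel (T : countType) (R : T -> T -> Prop) : Prop :=
  exists c : recf, forall x y : T,
    (R x y -> recf_eval c [:: pickle x; pickle y] 1) /\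
    (~ R x y -> recf_eval c [:: pickle x; pickle y] 0).

(* Main.v *)
Require Import Defs.
From mathcomp Require Import all_boot.
From Stdlib Require List.
From Stdlib Require Import FunctionalExtensionality PropExtensionality ProofIrrelevance.

(** A term [t] denotes a binary relation on every edge-labelled directed graph:
    product is composition, [+] and [*] are domain and range.  It also has a
    finite birooted tree [T(t)], and a pair of vertices of a graph lies in the
    relation of [t] iff it is the image of the two roots under a morphism from
    [T(t)].  Two terms are equal in the free adequate monoid iff there are
    morphisms [T(t) -> T(u)] and [T(u) -> T(t)].

    If a graph has at most one directed path between two vertices, its relations
    all of whose pairs are at one fixed distance form an adequate monoid; taking
    the graph [T(u)] shows that an equation yields the morphisms.

    Conversely, in an adequate monoid, call an assignment [rho] of idempotents to
    vertices consistent if [rho x <= (a (rho y))^+] and [rho y <= ((rho x) a)^*]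
    for every edge [x -a-> y].  [T(t)] has a largest consistent assignment, and
    [t] is the product of its values and of the letters along the path between
    the roots.  Pulling back along morphisms in both directions shows that these
    products agree for [t] and [u].  Semigroups reduce to monoids by adjoining an
    identity.

    The morphism test is computed by evaluating terms bottom-up on finite trees
    and finite relations coded as numbers. *)

Set Implicit Arguments.
Unset Strict Implicit.
Unset Printing Implicit Defensive.

(** * Closure properties of computable functions *)

(** Only the values of [f] on sequences of length [n] matter. Since [f] is total, its program has to
    terminate on all of these. *)
Definition computable (n : nat) (f : seq nat -> nat) : Prop :=
  exists c, forall v, size v = n -> recf_eval c v (f v).

Definition computable1 (f : nat -> nat) : Prop :=
  computable 1 (fun v => f (nth 0 v 0)).

Definition computable2 (f : nat -> nat -> nat) : Prop :=
  computable 2 (fun v => f (nth 0 v 0) (nth 0 v 1)).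

Definition computable3 (f : nat -> nat -> nat -> nat) : Prop :=
  computable 3 (fun v => f (nth 0 v 0) (nth 0 v 1) (nth 0 v 2)).

Lemma computable_ext n f g :
  (forall v, size v = n -> f v = g v) -> computable n f -> computable n g.
Proof. by move=> fg [c cf]; exists c => v sv; rewrite -fg //; apply: cf. Qed.

Lemma computable_var n i : i < n -> computable n (fun v => nth 0 v i).
Proof. by move=> lt_in; exists (RProj i) => v sv; apply: ev_proj; rewrite sv. Qed.

Lemma computable_comp n k f (gs : seq (seq nat -> nat)) :
    size gs = k -> computable k f -> List.Forall (computable n) gs ->
  computable n (fun v => f [seq g v | g <- gs]).
Proof.
move=> sgs [c cf] cgs.
have [cs csP] : exists cs, forall v, size v = n ->
    List.Forall2 (fun c y => recf_eval c v y) cs [seq g v | g <- gs].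
  elim: cgs => [|g gs' [d dP] _ [cs csP]]; first by exists [::] => v _; constructor.
  by exists (d :: cs) => v sv; constructor; [apply: dP | apply: csP].
exists (RComp c cs) => v sv; apply: ev_comp (csP v sv) _.
by apply: cf; rewrite size_map.
Qed.

Lemma computable_app1 F n f :
  computable1 F -> computable n f -> computable n (fun v => F (f v)).
Proof.
by move=> cF cf; apply: (computable_comp (gs := [:: f]) _ cF) => //; do !constructor.
Qed.

Lemma computable_app2 F n f g :
    computable2 F -> computable n f -> computable n g ->
  computable n (fun v => F (f v) (g v)).
Proof.
move=> cF cf cg.
by apply: (computable_comp (gs := [:: f; g]) _ cF) => //; do !constructor.
Qed.

Lemma computable_app3 F n f g h :
    computable3 F -> computable n f -> computable n g -> computable n h ->
  computable n (fun v => F (f v) (g v) (h v)).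
Proof.
move=> cF cf cg ch.
by apply: (computable_comp (gs := [:: f; g; h]) _ cF) => //; do !constructor.
Qed.

Lemma computable_succ n f : computable n f -> computable n (fun v => (f v).+1).
Proof.
apply: (@computable_app1 succn).
by exists RSucc => -[|x v] // _; apply: ev_succ.
Qed.

Lemma computable_const n k : computable n (fun=> k).
Proof.
elim: k => [|k IHk]; first by exists RZero => v _; apply: ev_zero.
exact: computable_succ.
Qed.

Lemma Forall_projections n k m : k + m <= n ->
  List.Forall (computable n) [seq (fun v => nth 0 v i) | i <- iota k m].
Proof.
elim: m k => [|m IHm] k lekn /=; first by constructor.
constructor; last by apply: IHm; rewrite addSnnS.
by apply: computable_var; apply: leq_trans lekn; rewrite -addSnnS leq_addr.
Qed.

Lemma map_projections (v : seq nat) k m : k + m = size v ->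
  [seq g v | g <- [seq (fun v => nth 0 v i) | i <- iota k m]] = drop k v.
Proof.
move=> sv; apply: (@eq_from_nth _ 0); first by rewrite !size_map size_iota size_drop -sv addKn.
move=> i; rewrite !size_map size_iota => lt_im.
by rewrite -map_comp (nth_map 0) ?size_iota //= nth_iota // nth_drop.
Qed.

(** Weakening: a recursion puts its counter and accumulator in front of the parameters, and a
    function of the parameters has to be usable behind them. *)
Lemma computable_drop n k f :
  computable n f -> computable (k + n) (fun v => f (drop k v)).
Proof.
move=> cf; pose gs := [seq (fun v : seq nat => nth 0 v i) | i <- iota k n].
apply: (@computable_ext _ (fun v => f [seq g v | g <- gs])) => [v sv|].
  by rewrite map_projections.
by apply: computable_comp cf _; [rewrite size_map size_iota | apply: Forall_projections].
Qed.

(** In the step, position 0 holds the counter, position 1 the accumulator and the parameters follow,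
    as in [RPrec]. The recursion is first run on the head argument, for which [c] is then
    substituted. *)
Lemma computable_nat_rec n (c b : seq nat -> nat) (s : nat -> nat -> seq nat -> nat) :
    computable n c -> computable n b ->
    computable n.+2 (fun w => s (nth 0 w 0) (nth 0 w 1) (drop 2 w)) ->
  computable n (fun v => nat_rec (fun=> nat) (b v) (fun i r => s i r v) (c v)).
Proof.
move=> cc [d dP] [e eP].
pose F w := nat_rec (fun=> nat) (b (behead w)) (fun i r => s i r (behead w)) (head 0 w).
have cF : computable n.+1 F.
  exists (RPrec d e) => -[|m v] //= [sv]; rewrite /F /=.
  elim: m => [|m IHm] /=; first by apply: ev_prec0; apply: dP.
  apply: ev_precS IHm _; set r := nat_rec _ _ _ _.
  by have := eP [:: m, r & v]; rewrite /= drop0; apply; rewrite sv.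
pose gs := [seq (fun v : seq nat => nth 0 v i) | i <- iota 0 n].
apply: (@computable_ext _ (fun v => F [seq g v | g <- c :: gs])) => [v sv|].
  by rewrite /= map_projections // drop0.
apply: computable_comp cF _; first by rewrite /= size_map size_iota.
by constructor=> //; apply: Forall_projections.
Qed.

Lemma iter_nat_rec (T : Set) n (f : T -> T) x :
  iter n f x = nat_rec (fun=> T) x (fun _ => f) n.
Proof. by elim: n => //= n ->. Qed.

Lemma computable_iter n (c b : seq nat -> nat) (s : nat -> seq nat -> nat) :
    computable n c -> computable n b ->
    computable n.+2 (fun w => s (nth 0 w 1) (drop 2 w)) ->
  computable n (fun v => iter (c v) (fun r => s r v) (b v)).
Proof.
move=> cc cb cs; have := computable_nat_rec (s := fun _ => s) cc cb cs.
by apply: computable_ext => v _; rewrite iter_nat_rec.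
Qed.

Lemma computable_if0 n (c a b : seq nat -> nat) :
    computable n c -> computable n a -> computable n b ->
  computable n (fun v => if c v is 0 then a v else b v).
Proof.
move=> cc ca cb; have := @computable_nat_rec n c a (fun _ _ v => b v) cc ca.
move=> /(_ (@computable_drop n 2 _ cb)).
by apply: computable_ext => v _; case: (c v).
Qed.

Lemma computable_pred : computable1 predn.
Proof.
have v0 : computable 1 (nth 0 ^~ 0) by apply: computable_var.
have := @computable_nat_rec 1 _ _ (fun i _ _ => i) v0 (computable_const 1 0).
move=> /(_ (@computable_var 3 0 isT)); apply: computable_ext => v _.
by case: (nth 0 v 0).
Qed.

Lemma computable_subn : computable2 subn.
Proof.
have v0 : computable 2 (nth 0 ^~ 0) by apply: computable_var.
have v1 : computable 2 (nth 0 ^~ 1) by apply: computable_var.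
have := @computable_iter 2 _ _ (fun r _ => r.-1) v1 v0.
move=> /(_ (computable_app1 computable_pred (@computable_var 4 1 isT))).
by apply: computable_ext => v _; elim: (nth 0 v 1) => [|m /= ->]; rewrite ?subn0 ?subnS.
Qed.

(** Two numbers are equal iff both truncated differences vanish, so two nested zero tests
    suffice. *)
Lemma computable_eqn n (f g a b : seq nat -> nat) :
    computable n f -> computable n g -> computable n a -> computable n b ->
  computable n (fun v => if f v == g v then a v else b v).
Proof.
move=> cf cg ca cb.
have cfg := computable_app2 computable_subn cf cg.
have cgf := computable_app2 computable_subn cg cf.
apply: computable_ext (computable_if0 cfg (computable_if0 cgf ca cb) cb) => v _ /=.
rewrite eqn_leq -!subn_eq0.
by case: (f v - g v) => //; case: (g v - f v).
Qed.

Lemma computable_double : computable1 double.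
Proof.
have v0 : computable 1 (nth 0 ^~ 0) by apply: computable_var.
have := @computable_iter 1 _ _ (fun r _ => r.+2) v0 (computable_const 1 0).
move=> /(_ (computable_succ (computable_succ (@computable_var 3 1 isT)))).
by apply: computable_ext => v _; elim: (nth 0 v 0) => [|m /= ->].
Qed.

Lemma computable_odd : computable1 (fun x => odd x : nat).
Proof.
have v0 : computable 1 (nth 0 ^~ 0) by apply: computable_var.
have := @computable_iter 1 _ _ (fun r _ => 1 - r) v0 (computable_const 1 0).
move=> /(_ (computable_app2 computable_subn (computable_const 3 1) (@computable_var 3 1 isT))).
by apply: computable_ext => v _; elim: (nth 0 v 0) => [|m /= ->] //; case: (odd m).
Qed.

(** Passing from [m] to [m.+1] raises the half by one exactly when [m] is odd. *)
Lemma computable_half : computable1 half.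
Proof.
have v0 : computable 1 (nth 0 ^~ 0) by apply: computable_var.
pose s (i r : nat) (v : seq nat) := if (odd i : nat) is 0 then r else r.+1.
have := @computable_nat_rec 1 _ _ s v0 (computable_const 1 0).
have cs : computable 3 (fun w => s (nth 0 w 0) (nth 0 w 1) (drop 2 w)).
  apply: computable_if0 (computable_var _) (computable_succ (computable_var _)) => //.
  exact: computable_app1 computable_odd (computable_var _).
move=> /(_ cs); apply: computable_ext => v _.
elim: (nth 0 v 0) => //= m ->; rewrite uphalf_half /s.
by case: (odd m).
Qed.

(** * Lists of numbers as numbers *)

(** Every number codes exactly one list, and 0 codes the empty one. The same operation serves as a
    pairing function, with [chd] and [ctl] as projections. *)
Definition ccons (x c : nat) : nat := CodeSeq.code (x :: CodeSeq.decode c).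
Definition chd (c : nat) : nat := head 0 (CodeSeq.decode c).
Definition ctl (c : nat) : nat := CodeSeq.code (behead (CodeSeq.decode c)).

Lemma cconsE x c : ccons x c = 2 ^ x * c.*2.+1.
Proof. by rewrite /ccons /= CodeSeq.decodeK. Qed.

Lemma decode_ccons x c : CodeSeq.decode (ccons x c) = x :: CodeSeq.decode c.
Proof. exact: CodeSeq.codeK. Qed.

Lemma chd_ccons x c : chd (ccons x c) = x.
Proof. by rewrite /chd decode_ccons. Qed.

Lemma ctl_ccons x c : ctl (ccons x c) = c.
Proof. by rewrite /ctl decode_ccons /= CodeSeq.decodeK. Qed.

Lemma ccons_inj x y c d : ccons x c = ccons y d -> x = y /\ c = d.
Proof.
by move=> e; have := f_equal chd e; have := f_equal ctl e; rewrite !chd_ccons !ctl_ccons.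
Qed.

Lemma code_cases c : c = 0 \/ exists x d, c = ccons x d.
Proof.
rewrite -[c]CodeSeq.decodeK; case: (CodeSeq.decode c) => [|x s]; first by left.
by right; exists x, (CodeSeq.code s); rewrite /ccons CodeSeq.codeK.
Qed.

Lemma decode_ctl c : CodeSeq.decode (ctl c) = behead (CodeSeq.decode c).
Proof. exact: CodeSeq.codeK. Qed.

Lemma computable_ccons : computable2 ccons.
Proof.
have v0 : computable 2 (nth 0 ^~ 0) by apply: computable_var.
have v1 : computable 2 (nth 0 ^~ 1) by apply: computable_var.
have c1 := computable_succ (computable_app1 computable_double v1).
have := @computable_iter 2 _ _ (fun r _ => r.*2) v0 c1.
move=> /(_ (computable_app1 computable_double (@computable_var 4 1 isT))).
apply: computable_ext => v _; rewrite cconsE.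
elim: (nth 0 v 0) => [|m /= ->]; first by rewrite mul1n.
by rewrite expnS -mulnA mul2n.
Qed.

Lemma iter_half x c : iter x half (2 ^ x * c) = c.
Proof. by elim: x c => [|x IHx] c; rewrite ?mul1n // iterSr expnS -mulnA mul2n doubleK IHx. Qed.

Lemma half_iter_low x r c : r <= x -> iter r half (2 ^ x * c) = 2 ^ (x - r) * c.
Proof. by move=> le_rx; rewrite -{1}(subnKC le_rx) expnD -mulnA iter_half. Qed.

(** The head of a nonempty list is the exponent of 2 in its code. The counter [r] grows as long as
    [c] halved [r] times is even; [c] rounds are enough because [x < 2 ^ x]. *)
Lemma chd_iter c :
  chd c = iter c (fun r => if (odd (iter r half c) : nat) is 0 then r.+1 else r) 0.
Proof.
case: (code_cases c) => [->//|[x [d ->]]]; rewrite chd_ccons.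
set c' := ccons x d.
have iterE m : iter m (fun r => if (odd (iter r half c') : nat) is 0 then r.+1 else r) 0
               = minn m x.
  elim: m => [|m IHm]; rewrite ?min0n // iterS IHm /c' cconsE. rewrite half_iter_low ?geq_minr //.
  have [le_xm|lt_mx] := leqP x m.
    by rewrite subnn mul1n /= odd_double (minn_idPr (leqW le_xm)).
  rewrite (minn_idPl lt_mx) -(subnSK lt_mx) expnS.
  by rewrite -mulnA oddM.
rewrite iterE; symmetry; apply/minn_idPr; rewrite /c' cconsE.
apply: leq_trans (leq_pmulr _ _) => //.
by apply: ltnW; apply: ltn_expl.
Qed.

Lemma ctl_iter c : ctl c = (iter (chd c) half c)./2.
Proof.
case: (code_cases c) => [->//|[x [d ->]]]; rewrite chd_ccons ctl_ccons cconsE iter_half.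
by rewrite -[_.+1]/(true + d.*2) half_bit_double.
Qed.

Lemma computable_iter_half : computable2 (fun r c => iter r half c).
Proof.
have v0 : computable 2 (nth 0 ^~ 0) by apply: computable_var.
have v1 : computable 2 (nth 0 ^~ 1) by apply: computable_var.
apply: (@computable_iter 2 _ _ (fun r _ => r./2) v0 v1).
exact: computable_app1 computable_half (@computable_var 4 1 isT).
Qed.

Lemma computable_chd : computable1 chd.
Proof.
have v0 : computable 1 (nth 0 ^~ 0) by apply: computable_var.
pose s r (v : seq nat) := if (odd (iter r half (nth 0 v 0)) : nat) is 0 then r.+1 else r.
apply: (@computable_ext _ (fun v => iter (nth 0 v 0) (s^~ v) 0)) => [v _|].
  by rewrite chd_iter.
apply: computable_iter => //; first exact: computable_const.
apply: computable_if0; last exact: computable_var.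
  apply: computable_app1 computable_odd _.
  apply: computable_app2 computable_iter_half _ _; first exact: computable_var.
  exact: (@computable_drop 1 2 _ v0).
exact/computable_succ/computable_var.
Qed.

Lemma computable_ctl : computable1 ctl.
Proof.
have v0 : computable 1 (nth 0 ^~ 0) by apply: computable_var.
apply: (@computable_ext _ (fun v => (iter (chd (nth 0 v 0)) half (nth 0 v 0))./2)) => [v _|].
  by rewrite ctl_iter.
apply: computable_app1 computable_half _.
apply: (computable_app2 computable_iter_half _ v0).
exact: computable_app1 computable_chd v0.
Qed.

Lemma decode_iter_ctl k c : CodeSeq.decode (iter k ctl c) = drop k (CodeSeq.decode c).
Proof.
elim: k => [|k IHk]; first by rewrite drop0.
by rewrite iterS decode_ctl IHk -drop1 drop_drop add1n.
Qed.

(** This lets a code serve as the number of rounds of a loop over the list that it codes. *)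
Lemma size_decode c : size (CodeSeq.decode c) <= c.
Proof.
rewrite -{2}[c]CodeSeq.decodeK; elim: (CodeSeq.decode c) => //= x s IHs.
apply: leq_trans (leq_pmull _ _); last by rewrite expn_gt0.
by rewrite ltnS -addnn (leq_trans IHs) // leq_addr.
Qed.

Lemma computable_foldr n (l z : seq nat -> nat) (s : nat -> nat -> seq nat -> nat) :
    computable n l -> computable n z ->
    computable n.+2 (fun w => s (nth 0 w 0) (nth 0 w 1) (drop 2 w)) ->
  computable n (fun v => foldr (fun x r => s x r v) (z v) (CodeSeq.decode (l v))).
Proof.
move=> cl cz cs.
(* The list is folded from the right: [rest i v] codes its suffix from position [l v - i.+1]. Past
   the end of the list this is 0, and the accumulator is kept. *)
pose rest i v := iter (l v - i.+1) ctl (l v).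
pose s' i r v := if rest i v is 0 then r else s (chd (rest i v)) r v.
apply: (@computable_ext _ (fun v => nat_rec (fun=> nat) (z v) (fun i r => s' i r v) (l v))).
  move=> v _; set c := l v.
  suffices foldP i : i <= c -> nat_rec (fun=> nat) (z v) (fun i r => s' i r v) i =
      foldr (fun x r => s x r v) (z v) (drop (c - i) (CodeSeq.decode c)).
    by rewrite foldP // subnn drop0.
  elim: i => [_|i IHi lt_ic]; first by rewrite subn0 drop_oversize ?size_decode.
  rewrite /= (IHi (ltnW lt_ic)) /s' /rest -/c -(subnSK lt_ic).
  move: (c - i.+1) => j.
  rewrite -[j.+1]add1n -drop_drop drop1 -decode_iter_ctl.
  case: (code_cases (iter j ctl c)) => [->//|[x [d ->]]].
  by rewrite decode_ccons chd_ccons /= cconsE -(prednK (expn_gt0 2 x)).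
have cit : computable n.+2 (fun w => rest (nth 0 w 0) (drop 2 w)).
  apply: (@computable_iter n.+2 (fun w => l (drop 2 w) - (nth 0 w 0).+1)
            (fun w => l (drop 2 w)) (fun r _ => ctl r)).
  - apply: computable_app2 computable_subn _ _; first exact: (@computable_drop n 2 _ cl).
    by apply: computable_succ; apply: computable_var.
  - exact: (@computable_drop n 2 _ cl).
  by apply: computable_app1 computable_ctl _; apply: computable_var.
apply: computable_nat_rec => //; apply: computable_if0 => //; first exact: computable_var.
pose gs := [:: (fun w => chd (rest (nth 0 w 0) (drop 2 w))), (fun w => nth 0 w 1)
             & [seq (fun v : seq nat => nth 0 v i) | i <- iota 2 n]].
pose t w := s (nth 0 w 0) (nth 0 w 1) (drop 2 w).
apply: (@computable_ext _ (fun w => t [seq g w | g <- gs])) => [w sw|].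
  by rewrite /t /= drop0 map_projections.
apply: (computable_comp _ cs); first by rewrite /= size_map size_iota.
constructor; first exact: computable_app1 computable_chd _.
by constructor; [apply: computable_var | apply: Forall_projections].
Qed.

(** * Adequate semigroups *)

(** Reversing the product exchanges [Rstar] and [Lstar], so each fact about [plus] yields one about
    [star]. *)
Lemma adequate_op S (mul : S -> S -> S) plus star :
  is_adequate mul plus star -> is_adequate (fun a b => mul b a) star plus.
Proof.
by case=> assoc comm plusP starP; split=> // e f ie jf; apply: comm.
Qed.

Section Adequate.

Variables (S : Type) (mul : S -> S -> S) (plus star : S -> S).
Hypothesis adS : is_adequate mul plus star.

Local Notation "a ∘ b" := (mul a b) (at level 40, left associativity).
Local Notation idem := (idempotent_el mul).
Local Notation "e ≼ f" := (e ∘ f = e) (at level 70).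

Lemma ad_assoc a b c : a ∘ (b ∘ c) = a ∘ b ∘ c.
Proof. by case: adS. Qed.

Lemma ad_idemC e f : idem e -> idem f -> e ∘ f = f ∘ e.
Proof. by case: adS => _ + _ _; apply. Qed.

Lemma idem_plus a : idem (plus a).
Proof. by case: adS => _ _ /(_ a)[]. Qed.

Lemma idem_star a : idem (star a).
Proof. by case: adS => _ _ _ /(_ a)[]. Qed.

Lemma plusK a : plus a ∘ a = a.
Proof. by case: adS => _ _ /(_ a)[ip /(_ (Some (plus a)) None)[_ /(_ ip)]]. Qed.

Lemma plus_cancel x y a : x ∘ a = y ∘ a -> x ∘ plus a = y ∘ plus a.
Proof. by case: adS => _ _ /(_ a)[_ /(_ (Some x) (Some y))[]]. Qed.

(** Together with [plusK] this makes [plus a] the least idempotent that fixes [a] from the left.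
    Below, [plus a ≼ e] is obtained by checking [e ∘ a = a]. *)
Lemma plus_fix x a : x ∘ a = a -> x ∘ plus a = plus a.
Proof. by case: adS => _ _ /(_ a)[_ /(_ (Some x) None)[]]. Qed.

Lemma idemM e f : idem e -> idem f -> idem (e ∘ f).
Proof.
by move=> ie jf; rewrite /idem ad_assoc -(ad_assoc e) (ad_idemC jf ie) ad_assoc ie -ad_assoc jf.
Qed.

Lemma ile_trans e f g : e ≼ f -> f ≼ g -> e ≼ g.
Proof. by move=> <- fg; rewrite -ad_assoc fg. Qed.

Lemma ile_meet e f g : g ≼ e -> g ≼ f -> g ≼ e ∘ f.
Proof. by move=> ge gf; rewrite ad_assoc ge. Qed.

Lemma ile_antisym e f : idem e -> idem f -> e ≼ f -> f ≼ e -> e = f.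
Proof. by move=> ie jf ef fe; rewrite -ef ad_idemC. Qed.

Lemma ile_mull e f : idem e -> idem f -> e ∘ f ≼ e.
Proof. by move=> ie jf; rewrite (ad_idemC ie jf) -ad_assoc ie. Qed.

Lemma ile_mulr e f : idem f -> e ∘ f ≼ f.
Proof. by move=> jf; rewrite -ad_assoc jf. Qed.

Lemma plus_idem e : idem e -> plus e = e.
Proof.
move=> ie; apply: ile_antisym => //; first exact: idem_plus.
  by rewrite ad_idemC ?plus_fix //; apply: idem_plus.
by rewrite ad_idemC ?plusK //; apply: idem_plus.
Qed.

(** Each side is below the other: [plus (a ∘ plus b)] fixes [a ∘ b], and [plus (a ∘ b)] fixes
    [a ∘ plus b] once the factor [b] is replaced by [plus b] through [plus_cancel]. *)
Lemma plusM a b : plus (a ∘ b) = plus (a ∘ plus b).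
Proof.
have ip := idem_plus; apply: ile_antisym => //.
  have -> : a ∘ b = a ∘ plus b ∘ b by rewrite -ad_assoc plusK.
  by rewrite ad_idemC // plus_fix // ad_assoc plusK.
rewrite ad_idemC // plus_fix // ad_assoc.
by apply: plus_cancel; rewrite -ad_assoc plusK.
Qed.

Lemma plus_idemM e a : idem e -> plus (e ∘ a) = e ∘ plus a.
Proof. by move=> ie; rewrite plusM plus_idem //; apply: idemM => //; apply: idem_plus. Qed.

Lemma plus_mono a e f : idem e -> idem f -> e ≼ f -> plus (a ∘ e) ≼ plus (a ∘ f).
Proof.
move=> ie jf ef; rewrite ad_idemC ?plus_fix //; try exact: idem_plus.
by rewrite -ef (ad_idemC ie jf) !ad_assoc -(ad_assoc (plus _)) plusK.
Qed.

Lemma plusM_le a b : plus (a ∘ b) ≼ plus a.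
Proof. by rewrite ad_idemC ?plus_fix //; try exact: idem_plus; rewrite ad_assoc plusK. Qed.

End Adequate.

Section AdequateDual.

Variables (S : Type) (mul : S -> S -> S) (plus star : S -> S).
Hypothesis adS : is_adequate mul plus star.
Let opS := adequate_op adS.

Local Notation "a ∘ b" := (mul a b) (at level 40, left associativity).
Local Notation idem := (idempotent_el mul).
Local Notation "e ≼ f" := (e ∘ f = e) (at level 70).

Lemma starK a : a ∘ star a = a.
Proof. exact: (plusK opS). Qed.

Lemma star_idem e : idem e -> star e = e.
Proof. exact: (plus_idem opS). Qed.

Lemma starM a b : star (a ∘ b) = star (star a ∘ b).
Proof. exact: (plusM opS). Qed.

Lemma star_idemM e a : idem e -> star (a ∘ e) = star a ∘ e.
Proof. exact: (plus_idemM opS). Qed.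

Lemma star_mono a e f : idem e -> idem f -> e ≼ f -> star (e ∘ a) ≼ star (f ∘ a).
Proof.
move=> ie jf ef; rewrite (ad_idemC adS); try exact: (idem_star adS).
by apply: (plus_mono opS) => //; rewrite (ad_idemC adS).
Qed.

Lemma starM_le a b : star (a ∘ b) ≼ star b.
Proof. by rewrite (ad_idemC adS); try exact: (idem_star adS); apply: (plusM_le opS). Qed.

End AdequateDual.

Lemma cat_inj (T : Type) (s1 s2 s3 s4 : seq T) :
  size s1 = size s3 -> s1 ++ s2 = s3 ++ s4 -> s1 = s3 /\ s2 = s4.
Proof.
move=> s13 e; split.
  by move/(congr1 (take (size s1))): e; rewrite take_size_cat // s13 take_size_cat.
by move/(congr1 (drop (size s1))): e; rewrite drop_size_cat // s13 drop_size_cat.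
Qed.

(** * Relations on graphs with unique paths *)

Section Graphs.

Variables (V A : Type) (edge : V -> A -> V -> Prop).

Fixpoint gpath (x : V) (l : seq (A * V)) (y : V) : Prop :=
  if l is (a, z) :: l' then edge x a z /\ gpath z l' y else x = y.

Definition unique_paths : Prop :=
  forall x y l l', gpath x l y -> gpath x l' y -> l = l'.

Fixpoint trel (t : mterm A) (x y : V) : Prop :=
  match t with
  | MVar a => edge x a y
  | MOne => x = y
  | MMul t u => exists2 z, trel t x z & trel u z y
  | MPlus t => x = y /\ exists z, trel t x z
  | MStar t => x = y /\ exists z, trel t z y
  end.

Lemma gpath_cat x l l' y z : gpath x l y -> gpath y l' z -> gpath x (l ++ l') z.
Proof. by elim: l x => [|[a v] l IHl] x /= => [->//|[xv vl] /(IHl _ vl)]. Qed.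

Lemma gpath_inj x l y z : gpath x l y -> gpath x l z -> y = z.
Proof. by elim: l x => [|[a v] l IHl] x /= => [->//|[_ vl] [_]]; apply: IHl. Qed.

(** One length for all pairs is what gives cancellation: where a unique path splits into two factors
    is then determined by their lengths. *)
Definition fixed_length (R : V -> V -> Prop) : Prop :=
  exists n, forall x y, R x y -> exists2 l, size l = n & gpath x l y.

Definition flrel := {R : V -> V -> Prop | fixed_length R}.

Lemma flrel_eq (r s : flrel) :
  (forall x y, sval r x y <-> sval s x y) -> r = s.
Proof.
case: r s => [R pR] [Q pQ] /= eRQ.
have {}eRQ : R = Q.
  by do 2![apply: functional_extensionality => ?]; apply: propositional_extensionality.
by case: Q / eRQ pQ => pQ; rewrite (proof_irrelevance _ pR pQ).
Qed.

Lemma fixed_length_var a : fixed_length (fun x y => edge x a y).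
Proof. by exists 1 => x y xy; exists [:: (a, y)]. Qed.

Lemma fixed_length_sub (P : V -> Prop) : fixed_length (fun x y => x = y /\ P y).
Proof. by exists 0 => x y [-> _]; exists [::]. Qed.

Lemma fixed_length_one : fixed_length (fun x y => x = y).
Proof. by exists 0 => x y ->; exists [::]. Qed.

Lemma fixed_length_mul (r s : flrel) :
  fixed_length (fun x y => exists2 z, sval r x z & sval s z y).
Proof.
case: r s => [R [n nR]] [Q [m mQ]] /=; exists (n + m) => x y [z /nR[l sl xz] /mQ[l' sl' zy]].
by exists (l ++ l'); [rewrite size_cat sl sl' | apply: gpath_cat xz zy].
Qed.

Definition fvar a : flrel := exist _ _ (fixed_length_var a).
Definition fone : flrel := exist _ _ fixed_length_one.
Definition fmul (r s : flrel) : flrel := exist _ _ (fixed_length_mul r s).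
Definition fplus (r : flrel) : flrel :=
  exist _ _ (fixed_length_sub (fun x => exists z, sval r x z)).
Definition fstar (r : flrel) : flrel :=
  exist _ _ (fixed_length_sub (fun y => exists z, sval r z y)).

Lemma sval_meval t x y :
  sval (meval fmul fplus fstar fone fvar t) x y <-> trel t x y.
Proof.
elim: t x y => [a||t IHt u IHu|t IHt|t IHt] x y //=.
- by split=> -[z /IHt xz /IHu zy]; exists z.
- by split=> -[-> [z /IHt yz]]; split=> //; exists z.
by split=> -[-> [z /IHt yz]]; split=> //; exists z.
Qed.

Hypothesis uniqP : unique_paths.

(** Idempotency gives a path of length [n + n] beside one of length [n]; uniqueness forces
    [n = 0]. *)
Lemma fidem_sub (r : flrel) x y : fmul r r = r -> sval r x y -> x = y.
Proof.
move=> rr rxy; case: (r) rr rxy => R [n nR] /(congr1 sval) /= rr Rxy.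
have [l sl xy] := nR _ _ Rxy.
have [z Rxz Rzy] : exists2 z, R x z & R z y by rewrite -[R] rr in Rxy.
have [[l1 sl1 xz] [l2 sl2 zy]] := (nR _ _ Rxz, nR _ _ Rzy).
have /(congr1 size) := uniqP xy (gpath_cat xz zy).
rewrite size_cat sl sl1 sl2 => /esym/eqP; rewrite -{3}[n]addn0 eqn_add2l => /eqP n0.
by move: xy; rewrite (size0nil (etrans sl n0)).
Qed.

(** Idempotents lie inside the identity relation and therefore commute. Cancellation compares the
    two factorizations of a single path. *)
Lemma flrel_adequate : is_adequate_monoid fmul fplus fstar fone.
Proof.
have mulA a b c : fmul a (fmul b c) = fmul (fmul a b) c.
  apply: flrel_eq => x y /=; split.
    by case=> z xz [w zw wy]; exists w => //; exists z.
  by case=> w [z xz zw] wy; exists z => //; exists w.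
have mul1 a : fmul fone a = a.
  by apply: flrel_eq => x y /=; split=> [[z ->]|xy]//; exists x.
have mulr1 a : fmul a fone = a.
  by apply: flrel_eq => x y /=; split=> [[z xz <-]|xy]//; exists y.
have idp a : fmul (fplus a) (fplus a) = fplus a.
  apply: flrel_eq => x y /=; split=> [[z [<- _]]//|[<- xz]].
  by exists x.
have ids a : fmul (fstar a) (fstar a) = fstar a.
  apply: flrel_eq => x y /=; split=> [[z [<- _]]//|[<- xz]].
  by exists x.
have pK a : fmul (fplus a) a = a.
  apply: flrel_eq => x y /=; split=> [[z [-> _]]//|xy].
  by exists x => //; split=> //; exists y.
have sK a : fmul a (fstar a) = a.
  apply: flrel_eq => x y /=; split=> [[z xz [<- _]]//|xy].
  by exists y => //; split=> //; exists x.
split=> //; split=> //.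
- move=> e f ie jf; apply: flrel_eq => x y /=.
  split=> -[z xz zy].
    by have xEz := fidem_sub ie xz; have zEy := fidem_sub jf zy; subst z y; exists x.
  by have xEz := fidem_sub jf xz; have zEy := fidem_sub ie zy; subst z y; exists x.
- move=> a; split=> // x y.
  (* The adjoined [None] acts as [fone], so both sides become products in the monoid. *)
  have E (z : option flrel) b : Defs.mul1 fmul z b = fmul (odflt fone z) b by case: z => /=.
  rewrite !E; split=> [xy|]; last first.
    by move/(congr1 (fmul^~ a)); rewrite -!mulA pK.
  suffices sub p q : fmul p a = fmul q a -> forall s m,
      sval (fmul p (fplus a)) s m -> sval (fmul q (fplus a)) s m.
    by apply: flrel_eq => s m; split; apply: sub.
  move=> pq s m /= [z psm [zm [e ame]]]; subst z; exists m; last by split=> //; exists e.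
  have [m' qsm ame'] : sval (fmul q a) s e by rewrite -pq; exists m.
  have [j jP] := proj2_sig a.
  have [[n nP] [k kP]] := (proj2_sig p, proj2_sig q).
  have [[l1 s1 p1] [l2 s2 p2]] := (nP _ _ psm, jP _ _ ame).
  have [[l3 s3 p3] [l4 s4 p4]] := (kP _ _ qsm, jP _ _ ame').
  (* Both composites run from [s] to [e] and end with a part of length [j], hence pass through the
     same middle vertex: [m = m']. *)
  have e1 := uniqP (gpath_cat p1 p2) (gpath_cat p3 p4).
  have s13 : size l1 = size l3.
    by apply/eqP; rewrite -(eqn_add2r j) -{1}s2 -s4 -!size_cat e1.
  have [e13 _] := cat_inj s13 e1.
  by rewrite -e13 in p3; rewrite (gpath_inj p1 p3).
- move=> a; split=> // x y.
  have E (z : option flrel) b : Defs.mulr1 fmul b z = fmul b (odflt fone z) by case: z => /=.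
  rewrite !E; split=> [xy|]; last first.
    by move/(congr1 (fmul a)); rewrite !mulA sK.
  suffices sub p q : fmul a p = fmul a q -> forall m e,
      sval (fmul (fstar a) p) m e -> sval (fmul (fstar a) q) m e.
    by apply: flrel_eq => s m; split; apply: sub.
  move=> pq m e /= [z [mz [s asm]] pme]; subst z; exists m; first by split=> //; exists s.
  have [m' asm' qme] : sval (fmul a q) s e by rewrite -pq; exists m.
  have [j jP] := proj2_sig a.
  have [[n nP] [k kP]] := (proj2_sig p, proj2_sig q).
  have [[l1 s1 p1] [l2 s2 p2]] := (jP _ _ asm, nP _ _ pme).
  have [[l3 s3 p3] [l4 s4 p4]] := (jP _ _ asm', kP _ _ qme).
  have e1 := uniqP (gpath_cat p1 p2) (gpath_cat p3 p4).
  have [e13 _] := cat_inj (etrans s1 (esym s3)) e1.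
  by rewrite -e13 in p3; rewrite (gpath_inj p1 p3).
Qed.

End Graphs.

(** * Birooted trees *)

Section Trees.

Variable A : eqType.

Record tree := Tree {troot : nat; tend : nat; tedges : seq (nat * A * nat)}.

Definition tedge (g : tree) (x : nat) (a : A) (y : nat) : Prop := (x, a, y) \in tedges g.

(** Vertices are numbers, so the copies of two trees are kept apart by a tag 0 or 1 paired with each
    vertex. [vjoin] makes the one exception, at the vertex where the trees are glued. *)
Definition vleft (x : nat) : nat := ccons 0 x.
Definition vright (x : nat) : nat := ccons 1 x.
Definition vjoin (e s x : nat) : nat := if x == s then vleft e else vright x.

Definition map_edges (f : nat -> nat) (es : seq (nat * A * nat)) :=
  [seq (f d.1.1, d.1.2, f d.2) | d <- es].

Definition tvar (a : A) : tree := Tree 0 1 [:: (0, a, 1)].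
Definition tone : tree := Tree 0 0 [::].
Definition tmul (g h : tree) : tree :=
  Tree (vleft (troot g)) (vjoin (tend g) (troot h) (tend h))
    (map_edges vleft (tedges g) ++ map_edges (vjoin (tend g) (troot h)) (tedges h)).
Definition tplus (g : tree) : tree := Tree (troot g) (troot g) (tedges g).
Definition tstar (g : tree) : tree := Tree (tend g) (tend g) (tedges g).

Definition term_tree : mterm A -> tree := meval tmul tplus tstar tone tvar.

(** A morphism from the tree of [t] to that of [u] is never constructed; its existence is expressed
    by the relation of [t] on the target. *)
Definition term_hom (t u : mterm A) : Prop :=
  trel (tedge (term_tree u)) t (troot (term_tree u)) (tend (term_tree u)).

Lemma map_edgesP f es x a y :
  reflect (exists2 d, d \in es & [/\ x = f d.1.1, a = d.1.2 & y = f d.2])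
          ((x, a, y) \in map_edges f es).
Proof.
apply: (iffP mapP) => -[d des]; first by case=> -> -> ->; exists d.
by case=> -> -> ->; exists d.
Qed.

Lemma tedge_mul g h x a y :
  tedge (tmul g h) x a y <->
    (exists2 d, d \in tedges g & [/\ x = vleft d.1.1, a = d.1.2 & y = vleft d.2]) \/
    (exists2 d, d \in tedges h & [/\ x = vjoin (tend g) (troot h) d.1.1, a = d.1.2
                                   & y = vjoin (tend g) (troot h) d.2]).
Proof.
rewrite /tedge /= mem_cat; split; first by case/orP=> /map_edgesP; [left|right].
by case=> /map_edgesP -> //; rewrite orbT.
Qed.

(** This is how a function on a glued tree is built from functions on its two parts; they have to
    agree at the gluing vertex. *)
Definition vcase (T : Type) (f1 f2 : nat -> T) (x : nat) : T :=
  if chd x == 0 then f1 (ctl x) else f2 (ctl x).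

Lemma vcase_left T (f1 f2 : nat -> T) x : vcase f1 f2 (vleft x) = f1 x.
Proof. by rewrite /vcase /vleft chd_ccons ctl_ccons. Qed.

Lemma vcase_join T (f1 f2 : nat -> T) e s x :
  f1 e = f2 s -> vcase f1 f2 (vjoin e s x) = f2 x.
Proof.
rewrite /vjoin /vright; case: eqP => [-> <-|_ _]; first exact: vcase_left.
by rewrite /vcase chd_ccons ctl_ccons.
Qed.

Lemma vjoin_root e s : vjoin e s s = vleft e.
Proof. by rewrite /vjoin eqxx. Qed.

(* Every edge is a bridge: [c] tells the two sides of the cut edge apart. *)
Definition bridged (g : tree) : Prop :=
  forall x a y, tedge g x a y -> exists c : nat -> bool,
    [/\ ~~ c x, c y & forall x' a' y', tedge g x' a' y' ->
                        (x', a', y') != (x, a, y) -> c x' = c y'].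

(** The cut is extended to the other tree by a constant, its value at the gluing vertex, so no edge
    there is cut. *)
Lemma bridged_mul g h : bridged g -> bridged h -> bridged (tmul g h).
Proof.
move=> bg bh x a y /tedge_mul[] [[[x0 a0] y0] /= d0 [-> -> ->]].
  have [c [cx cy cE]] := bg _ _ _ d0; pose c' := vcase c (fun=> c (tend g)).
  exists c'; split; rewrite /c' ?vcase_left // => x' a' y' /tedge_mul[].
    case=> [[[x1 a1] y1] /= d1 [-> -> ->]] ne; rewrite !vcase_left; apply: cE d1 _.
    by apply: contraNneq ne => -[-> -> ->].
  by case=> d _ [-> _ ->] _; rewrite !vcase_join.
have [c [cx cy cE]] := bh _ _ _ d0; pose c' := vcase (fun=> c (troot h)) c.
exists c'; split; rewrite /c' ?vcase_join // => x' a' y' /tedge_mul[].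
  by case=> d _ [-> _ ->] _; rewrite !vcase_left.
case=> [[[x1 a1] y1] /= d1 [-> -> ->]] ne; rewrite !vcase_join //; apply: cE d1 _.
by apply: contraNneq ne => -[-> -> ->].
Qed.

Lemma bridged_term t : bridged (term_tree t).
Proof.
elim: t => [a||t IHt u IHu|t IHt|t IHt] //; last exact: bridged_mul.
move=> x b y; rewrite /tedge inE => /eqP[-> -> ->].
exists (fun v => v == 1); split=> // x' a' y'; rewrite /tedge inE => /eqP[-> -> ->].
by rewrite eqxx.
Qed.

(** Suppose two paths with the same ends differ in their first edge, and cut the first edge of one.
    The common end lies on the far side, so the other path, starting on the near side, has to come
    back to [x] to cross. This closes a directed cycle, which [noloop] excludes. *)
Lemma bridged_unique g : bridged g -> unique_paths (tedge g).
Proof.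
move=> bg.
(* No path leaves the far side of the cut: the cut edge itself ends there. *)
have stay (c : nat -> bool) x a y v l w : c y -> (forall x' a' y', tedge g x' a' y' ->
    (x', a', y') != (x, a, y) -> c x' = c y') -> gpath (tedge g) v l w -> c v -> c w.
  move=> cy cE; elim: l v => [|[b z] l IHl] v /= => [->//|[vz zw] cv].
  apply: IHl zw _; have [[_ _ ->]//|ne] := eqVneq (v, b, z) (x, a, y).
  by rewrite -(cE _ _ _ vz ne).
(* A path from the near to the far side uses the cut edge, and so visits its source [x]. *)
have cross c x a y v l w : (forall x' a' y', tedge g x' a' y' ->
    (x', a', y') != (x, a, y) -> c x' = c y') -> gpath (tedge g) v l w ->
    ~~ c v -> c w -> exists l', gpath (tedge g) v l' x.
  move=> cE; elim: l v => [|[b z] l IHl] v /= => [-> /negP//|[vz zw] cv cw].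
  have [[-> _ _]|ne] := eqVneq (v, b, z) (x, a, y); first by exists [::].
  have [|l' zx] := IHl z zw _ cw; first by rewrite -(cE _ _ _ vz ne).
  by exists ((b, z) :: l').
have noloop x a y l : tedge g x a y -> ~ gpath (tedge g) y l x.
  move=> xy yx; have [c [cx cy cE]] := bg _ _ _ xy.
  by rewrite (stay _ _ _ _ _ _ _ cy cE yx cy) in cx.
move=> x y l; elim: l x => [|[a z] l IHl] x [|[b w] l'] //=.
- by move=> -> [yw wy]; case: (noloop _ _ _ _ yw wy).
- by move=> [xz zy] xEy; rewrite -xEy in zy; case: (noloop _ _ _ _ xz zy).
move=> [xz zy] [xw wy]; have [c [cx cz cE]] := bg _ _ _ xz.
have [[eba ewz]|ne] := eqVneq (b, w) (a, z).
  by rewrite eba ewz in wy *; rewrite (IHl _ _ zy wy).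
have {}ne : (x, b, w) != (x, a, z) by apply: contraNneq ne => -[-> ->].
have cw : ~~ c w by rewrite -(cE _ _ _ xw ne).
have [l3 wx] := cross _ _ _ _ _ _ _ cE wy cw (stay _ _ _ _ _ _ _ cz cE zy cz).
by case: (noloop _ _ _ _ xw wx).
Qed.

Lemma gpath_homo (V W : Type) (e : V -> A -> V -> Prop) (e' : W -> A -> W -> Prop)
    (f : V -> W) x l y :
    (forall x a y, e x a y -> e' (f x) a (f y)) -> gpath e x l y ->
  gpath e' (f x) [seq (d.1, f d.2) | d <- l] (f y).
Proof.
move=> fP; elim: l x => [|[a z] l IHl] x /= => [->//|[xz /IHl zy]].
by split=> //; apply: fP.
Qed.

Lemma trel_homo (V W : Type) (e : V -> A -> V -> Prop) (e' : W -> A -> W -> Prop)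
    (f : V -> W) t x y :
  (forall x a y, e x a y -> e' (f x) a (f y)) -> trel e t x y -> trel e' t (f x) (f y).
Proof.
move=> fP; elim: t x y => [a||t IHt u IHu|t IHt|t IHt] x y /=.
- exact: fP.
- by move->.
- by case=> z /IHt xz /IHu zy; exists (f z).
- by case=> -> [z /IHt xz]; split=> //; exists (f z).
by case=> -> [z /IHt xz]; split=> //; exists (f z).
Qed.

Lemma term_hom_refl t : term_hom t t.
Proof.
rewrite /term_hom; elim: t => [a||t IHt u IHu|t IHt|t IHt] //=.
- by rewrite /tedge inE.
- set g := term_tree t in IHt *; set h := term_tree u in IHu *.
  exists (vleft (tend g)).
    apply: (trel_homo (f := vleft)) IHt => x a y xy.
    by apply/tedge_mul; left; exists (x, a, y).
  rewrite -[vleft (tend g)](vjoin_root _ (troot h)).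
  apply: (trel_homo (f := vjoin (tend g) (troot h))) IHu => x a y xy.
  by apply/tedge_mul; right; exists (x, a, y).
- by split=> //; exists (tend (term_tree t)).
by split=> //; exists (troot (term_tree t)).
Qed.

(** * Consistent valuations in an adequate monoid *)

Section Soundness.

Variables (M : Type) (mul : M -> M -> M) (plus star : M -> M) (one : M) (iota : A -> M).
Hypothesis adM : is_adequate_monoid mul plus star one.
Let adS : is_adequate mul plus star := proj1 adM.

Local Notation "a ∘ b" := (mul a b) (at level 40, left associativity).
Local Notation "e ≼ f" := (e ∘ f = e) (at level 70).
Local Notation idem := (idempotent_el mul).
Local Notation "⟦ t ⟧" := (meval mul plus star one iota t) (at level 0, format "⟦ t ⟧").

Let assoc := ad_assoc adS.
Let idemC := ad_idemC adS.
Let iplus := idem_plus adS.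
Let istar := idem_star adS.

Lemma ad_mul1 a : one ∘ a = a. Proof. by case: (adM.2 a). Qed.
Lemma ad_mulr1 a : a ∘ one = a. Proof. by case: (adM.2 a). Qed.
Lemma idem_one : idem one. Proof. exact: ad_mul1. Qed.

Definition consistent (V : Type) (edge : V -> A -> V -> Prop) (rho : V -> M) : Prop :=
  (forall x, idem (rho x)) /\
  forall x a y, edge x a y ->
    rho x ≼ plus (iota a ∘ rho y) /\ rho y ≼ star (rho x ∘ iota a).

(** The edge inequalities compose: a pair in the relation of [t] behaves like an edge labelled
    [⟦t⟧]. *)
Lemma trel_le (V : Type) (edge : V -> A -> V -> Prop) rho t x y :
  consistent edge rho -> trel edge t x y ->
  rho x ≼ plus (⟦t⟧ ∘ rho y) /\ rho y ≼ star (rho x ∘ ⟦t⟧).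
Proof.
case=> irho rhoP; elim: t x y => [a||t IHt u IHu|t IHt|t IHt] x y /=.
- exact: rhoP.
- move->; rewrite ad_mul1 ad_mulr1 (plus_idem adS) // (star_idem adS) //.
  by split; apply: irho.
- case=> z /IHt[xz zx] /IHu[zy yz]; split.
    apply: (ile_trans adS) xz _.
    rewrite -assoc (plusM adS ⟦t⟧ (⟦u⟧ ∘ _)).
    by apply: (plus_mono adS) => //; apply: iplus.
  apply: (ile_trans adS) yz _.
  rewrite assoc (starM adS (_ ∘ ⟦t⟧)).
  by apply: (star_mono adS) => //; apply: istar.
- case=> -> [z /IHt[yz _]]; have ley := ile_trans adS yz (plusM_le adS _ _).
  rewrite (plus_idem adS (idemM adS (iplus _) (irho _))).
  rewrite (star_idem adS (idemM adS (irho _) (iplus _))).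
  split; [apply: (ile_meet adS) => // | apply: (ile_meet adS) => //]; exact: irho.
case=> -> [z /IHt[_ zy]]; have ley := ile_trans adS zy (starM_le adS _ _).
rewrite (plus_idem adS (idemM adS (istar _) (irho _))).
rewrite (star_idem adS (idemM adS (irho _) (istar _))).
split; [apply: (ile_meet adS) => // | apply: (ile_meet adS) => //]; exact: irho.
Qed.

(* The idempotents of the largest consistent valuation of [term_tree t] along
   the trunk, past the root, when [p] hangs at the root and [q] at the end. *)
Fixpoint trunk (t : mterm A) (p q : M) : seq (A * M) :=
  match t with
  | MVar a => [:: (a, q ∘ star (p ∘ iota a))]
  | MMul t u => trunk t p (plus (⟦u⟧ ∘ q)) ++ trunk u (star (p ∘ ⟦t⟧)) q
  | _ => [::]
  end.

Definition trunk_prod (m : M) (s : seq (A * M)) : M :=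
  foldl (fun m d => m ∘ iota d.1 ∘ d.2) m s.

Lemma trunk_prod_mul m m' s : trunk_prod (m ∘ m') s = m ∘ trunk_prod m' s.
Proof. by elim: s m' => //= d s IHs m'; rewrite -!assoc IHs. Qed.

(** The initial factor is the valuation at the root, so the values along the trunk alone recover the
    term. Side branches enter only through these idempotents. *)
Lemma trunk_prodE t p q : idem p -> idem q ->
  trunk_prod (p ∘ plus (⟦t⟧ ∘ q)) (trunk t p q) = p ∘ ⟦t⟧ ∘ q.
Proof.
elim: t p q => [a||t IHt u IHu|t IHt|t IHt] p q ip iq /=.
- rewrite assoc -(assoc p _ (iota a)) -(assoc p _ q) -(assoc _ (iota a) q) (plusK adS).
  rewrite assoc -(assoc (p ∘ iota a) q) (idemC iq) // assoc.
  by rewrite (starK adS).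
- by rewrite ad_mul1 ad_mulr1 (plus_idem adS).
- rewrite /trunk_prod foldl_cat -/(trunk_prod _ _) -/(trunk_prod _ _).
  rewrite -assoc (plusM adS ⟦t⟧) IHt //.
  (* The inserted [star (p ∘ ⟦t⟧)] completes the root value from which the trunk of [u] starts in
     [IHu]. *)
  have -> : p ∘ ⟦t⟧ ∘ plus (⟦u⟧ ∘ q) =
      p ∘ ⟦t⟧ ∘ (star (p ∘ ⟦t⟧) ∘ plus (⟦u⟧ ∘ q)) by rewrite assoc (starK adS).
  by rewrite trunk_prod_mul IHu // !assoc (starK adS).
- by rewrite (plus_idem adS) ?assoc //; apply: (idemM adS).
by rewrite (plus_idem adS) ?assoc //; apply: (idemM adS).
Qed.

Fixpoint trunk_le (s s' : seq (A * M)) : Prop :=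
  match s, s' with
  | [::], [::] => True
  | (a, e) :: s1, (b, f) :: s2 => [/\ a = b, e ≼ f & trunk_le s1 s2]
  | _, _ => False
  end.

Lemma trunk_le_cat s1 s2 s3 s4 :
  trunk_le s1 s2 -> trunk_le s3 s4 -> trunk_le (s1 ++ s3) (s2 ++ s4).
Proof. by elim: s1 s2 => [|[a e] s1 IHs] [|[b f] s2] //= [-> ef /IHs s12] /s12. Qed.

Lemma idem_trunk t p q a e : idem p -> idem q -> List.In (a, e) (trunk t p q) -> idem e.
Proof.
elim: t p q => [b||t IHt u IHu|t IHt|t IHt] p q ip iq //=.
  by case=> [[_ <-]|//]; apply: (idemM adS).
rewrite -/(List.In _) => /List.in_app_iff[]; first exact: IHt.
exact: IHu.
Qed.

Lemma trunk_le_antisym s s' :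
    (forall a e, List.In (a, e) s -> idem e) -> (forall a e, List.In (a, e) s' -> idem e) ->
  trunk_le s s' -> trunk_le s' s -> s = s'.
Proof.
elim: s s' => [|[a e] s IHs] [|[b f] s'] //= is1 is2 [-> ef ss'] [_ fe s's].
rewrite (IHs s') // => [|c g cg|c g cg].
- by rewrite (ile_antisym adS _ _ ef fe) //; [apply: (is1 a)|apply: (is2 b)]; left.
- by apply: (is1 c); right.
by apply: (is2 c); right.
Qed.

(** This is the maximality of the valuation recorded by [trunk]: any consistent [rho], pulled back
    along a morphism, stays below it if it does so at the two ends. *)
Lemma trel_trunk_le (V : Type) (edge : V -> A -> V -> Prop) rho t x y p q :
    consistent edge rho -> trel edge t x y -> idem p -> idem q ->
    rho x ≼ p -> rho y ≼ q ->
  exists2 l, gpath edge x l y & trunk_le [seq (d.1, rho d.2) | d <- l] (trunk t p q).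
Proof.
move=> rhoP; have [irho rhoE] := rhoP.
elim: t x y p q => [a||t IHt u IHu|t IHt|t IHt] x y p q /=.
- move=> xy ip iq xp yq; exists [:: (a, y)] => //=; split=> //.
  apply: (ile_meet adS) => //; have [_ yx] := rhoE _ _ _ xy.
  by apply: (ile_trans adS) yx _; apply: (star_mono adS).
- by move=> xy *; exists [::].
- case=> z xz zy ip iq xp yq.
  (* At the middle vertex, the bounds needed by the two induction hypotheses come from the opposite
     factors. *)
  have zq : rho z ≼ plus (⟦u⟧ ∘ q).
    by have [zy' _] := trel_le rhoP zy; apply: (ile_trans adS) zy' _; apply: (plus_mono adS).
  have zp : rho z ≼ star (p ∘ ⟦t⟧).
    by have [_ zx] := trel_le rhoP xz; apply: (ile_trans adS) zx _; apply: (star_mono adS).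
  have [l1 xl1 le1] := IHt _ _ _ _ xz ip (iplus _) xp zq.
  have [l2 zl2 le2] := IHu _ _ _ _ zy (istar _) iq zp yq.
  by exists (l1 ++ l2); [apply: gpath_cat xl1 zl2 | rewrite map_cat; apply: trunk_le_cat].
- by case=> xy _ *; exists [::].
by case=> xy _ *; exists [::].
Qed.

(** The values listed by [trunk] do come from a consistent valuation of the whole tree. The
    parameters [p] and [q] stand for what is attached at the root and at the end, which makes the
    induction through products possible. *)
Lemma tree_valuation t p q : idem p -> idem q ->
  exists rho, [/\ consistent (tedge (term_tree t)) rho,
    rho (troot (term_tree t)) = p ∘ plus (⟦t⟧ ∘ q),
    rho (tend (term_tree t)) = q ∘ star (p ∘ ⟦t⟧) &
    exists2 l, gpath (tedge (term_tree t)) (troot (term_tree t)) l (tend (term_tree t))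
             & [seq (d.1, rho d.2) | d <- l] = trunk t p q].
Proof.
elim: t p q => [a||t IHt u IHu|t IHt|t IHt] p q ip iq /=.
- pose rho v := if v == 0 then p ∘ plus (iota a ∘ q) else q ∘ star (p ∘ iota a).
  exists rho; split=> //; last first.
    by exists [:: (a, 1)] => //=; split=> //; rewrite /tedge inE.
  split=> [v|x b y]; first by rewrite /rho; case: eqP => _; apply: (idemM adS).
  rewrite /tedge inE => /eqP[-> -> ->]; rewrite /rho /=; split.
    (* With [p] moved under [plus], the factor [star (p ∘ iota a)] is absorbed by [starK]; moving
       [p] out again leaves a product with the required upper bound. *)
    rewrite -(plus_idemM adS _ ip) (assoc p).
    have -> : p ∘ iota a ∘ q = p ∘ (iota a ∘ (q ∘ star (p ∘ iota a))).
      by rewrite (idemC iq (istar _)) !assoc (starK adS).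
    by rewrite (plus_idemM adS _ ip); apply: (ile_mulr adS); apply: iplus.
  rewrite (idemC iq (istar _)) -(star_idemM adS _ iq).
  have -> : p ∘ iota a ∘ q = p ∘ plus (iota a ∘ q) ∘ iota a ∘ q.
    by rewrite -!assoc (plusK adS).
  by rewrite (star_idemM adS _ iq); apply: (ile_mull adS) => //; apply: istar.
- exists (fun=> p ∘ q); split; last by exists [::].
  + by split=> // x; apply: (idemM adS).
  + by rewrite ad_mul1 (plus_idem adS).
  by rewrite ad_mulr1 (star_idem adS) // idemC.
(* Seen from the left tree, the right one attached at its end contributes [plus (⟦u⟧ ∘ q)]; seen
   from the right tree, the left one contributes [star (p ∘ ⟦t⟧)]. The two valuations then agree
   where the trees are glued. *)
- have [r1 [[ir1 r1P] r1s r1e [l1 l1P r1l]]] := IHt p _ ip (iplus (⟦u⟧ ∘ q)).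
  have [r2 [[ir2 r2P] r2s r2e [l2 l2P r2l]]] := IHu _ q (istar (p ∘ ⟦t⟧)) iq.
  set g := term_tree t in r1P r1s r1e l1P *; set h := term_tree u in r2P r2s r2e l2P *.
  have r12 : r1 (tend g) = r2 (troot h) by rewrite r1e r2s idemC.
  have homl x a y : tedge g x a y -> tedge (tmul g h) (vleft x) a (vleft y).
    by move=> xy; apply/tedge_mul; left; exists (x, a, y).
  pose j := vjoin (tend g) (troot h).
  have homr x a y : tedge h x a y -> tedge (tmul g h) (j x) a (j y).
    by move=> xy; apply/tedge_mul; right; exists (x, a, y).
  exists (vcase r1 r2); split.
  + split=> [x|x a y /tedge_mul]; first by rewrite /vcase; case: eqP.
    by case=> -[d dP [-> -> ->]]; rewrite ?vcase_left ?vcase_join //; [apply: r1P|apply: r2P];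
      rewrite /tedge -!surjective_pairing.
  + by rewrite /= vcase_left r1s -(assoc _ ⟦u⟧) (plusM adS ⟦t⟧ (⟦u⟧ ∘ q)).
  + by rewrite /= vcase_join // r2e (assoc p) (starM adS (p ∘ ⟦t⟧)).
  exists ([seq (d.1, vleft d.2) | d <- l1] ++ [seq (d.1, j d.2) | d <- l2]); last first.
    rewrite map_cat -!map_comp -r1l -r2l; congr cat; apply: eq_map => d /=.
      by rewrite vcase_left.
    by rewrite vcase_join.
  apply: (@gpath_cat _ _ _ _ _ _ (vleft (tend g))).
    by apply: gpath_homo l1P.
  by rewrite -(vjoin_root _ (troot h)); apply: gpath_homo l2P.
(* Root and end coincide in the tree of [MPlus t], so [p] and [q] both hang at the root and [one] is
   left for the end of the subtree. *)
- have [r [rP rs re _]] := IHt (p ∘ q) one (idemM adS ip iq) idem_one.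
  have rsE : r (troot (term_tree t)) = p ∘ q ∘ plus ⟦t⟧ by rewrite rs ad_mulr1.
  exists r; split=> //; last by exists [::].
    by rewrite rsE (plus_idem adS (idemM adS (iplus _) iq)) (idemC (iplus _) iq) assoc.
  rewrite rsE (star_idem adS (idemM adS ip (iplus _))) assoc.
  by rewrite (idemC iq ip).
have [r [rP rs re _]] := IHt one (p ∘ q) idem_one (idemM adS ip iq).
have reE : r (tend (term_tree t)) = p ∘ q ∘ star ⟦t⟧ by rewrite re ad_mul1.
exists r; split=> //; last by exists [::].
  by rewrite reE (plus_idem adS (idemM adS (istar _) iq)) (idemC (istar _) iq) assoc.
rewrite reE (star_idem adS (idemM adS ip (istar _))) assoc.
by rewrite (idemC iq ip).
Qed.

(** The largest valuation of the tree of [u] is pulled back along the morphism and compared with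
    that of [t]. *)
Lemma term_hom_trunk_le t u : term_hom t u ->
  plus ⟦u⟧ ≼ plus ⟦t⟧ /\ trunk_le (trunk u one one) (trunk t one one).
Proof.
move=> tu; have [rho [rhoP rs re [l lP <-]]] := tree_valuation u idem_one idem_one.
rewrite ad_mul1 ad_mulr1 in rs.
have [le1 _] := trel_le rhoP tu; rewrite rs in le1.
split; first exact: (ile_trans adS) le1 (plusM_le adS _ _).
have [||l' l'P] := trel_trunk_le rhoP tu idem_one idem_one; try exact: ad_mulr1.
(* The path obtained from the morphism is the trunk of the tree of [u], as paths are unique. *)
by rewrite (bridged_unique (@bridged_term u) lP l'P).
Qed.

Lemma term_hom_sound t u : term_hom t u -> term_hom u t -> ⟦t⟧ = ⟦u⟧.
Proof.
move=> /term_hom_trunk_le[pu tu] /term_hom_trunk_le[pt ut].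
have E v : ⟦v⟧ = trunk_prod (plus ⟦v⟧) (trunk v one one).
  have := trunk_prodE v idem_one idem_one.
  by rewrite !ad_mul1 !ad_mulr1 => ->.
rewrite E [in RHS]E (ile_antisym adS (iplus _) (iplus _) pt pu).
congr trunk_prod; apply: trunk_le_antisym => // a e; apply: idem_trunk; exact: idem_one.
Qed.

End Soundness.

End Trees.

(** * Equality in free adequate semigroups and monoids *)

Lemma meval_morph (A M N : Type) (mulM : M -> M -> M) plusM starM oneM
    (mulN : N -> N -> N) plusN starN oneN (f : A -> M) (g : A -> N) (h : M -> N) t :
  is_ad_morphism mulM plusM starM mulN plusN starN h -> h oneM = oneN ->
  (forall a, h (f a) = g a) ->
  h (meval mulM plusM starM oneM f t) = meval mulN plusN starN oneN g t.
Proof.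
move=> [hM hP hS] h1 hf; elim: t => [a||t IHt u IHu|t IHt|t IHt] //=.
- by rewrite hM IHt IHu.
- by rewrite hP IHt.
by rewrite hS IHt.
Qed.

Fixpoint mterm_of_sterm (A : Type) (t : sterm A) : mterm A :=
  match t with
  | SVar a => MVar a
  | SMul t u => MMul (mterm_of_sterm t) (mterm_of_sterm u)
  | SPlus t => MPlus (mterm_of_sterm t)
  | SStar t => MStar (mterm_of_sterm t)
  end.

Lemma seval_meval (A M N : Type) (mulM : M -> M -> M) plusM starM
    (mulN : N -> N -> N) plusN starN oneN (f : A -> M) (g : A -> N) (h : M -> N) t :
  is_ad_morphism mulM plusM starM mulN plusN starN h -> (forall a, h (f a) = g a) ->
  h (seval mulM plusM starM f t) = meval mulN plusN starN oneN g (mterm_of_sterm t).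
Proof.
move=> [hM hP hS] hf; elim: t => [a|t IHt u IHu|t IHt|t IHt] //=.
- by rewrite hM IHt IHu.
- by rewrite hP IHt.
by rewrite hS IHt.
Qed.

Section AdjoinOne.

Variables (S : Type) (mul : S -> S -> S) (plus star : S -> S).

Definition opt_mul (x y : option S) : option S :=
  match x, y with
  | Some a, Some b => Some (mul a b)
  | Some a, None => Some a
  | None, _ => y
  end.

(** For elements of [S] the conditions reduce to those in [S], because the outer [None] and
    [Some None] act alike as identities. *)
Lemma adjoin_one_adequate : is_adequate mul plus star ->
  is_adequate_monoid opt_mul (omap plus) (omap star) None.
Proof.
move=> [assoc comm plusP starP]; split; last by case.
split.
- by move=> [a|] [b|] [c|] //=; rewrite assoc.
- by move=> [e|] [f|] //= [ie] [jf]; rewrite (comm e f).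
- case=> [a|]; split=> //=.
    by case: (plusP a) => ip _; rewrite /idempotent_el /= ip.
  have [_ ra] := plusP a.
  have E (z : option (option S)) b :
      mul1 opt_mul z (Some b) = Some (mul1 mul (odflt None z) b) by case: z => [[]|].
  by move=> x y; rewrite !E; split=> -[/ra ->].
case=> [a|]; split=> //=.
  by case: (starP a) => ip _; rewrite /idempotent_el /= ip.
have [_ ra] := starP a.
have E (z : option (option S)) b :
    mulr1 opt_mul (Some b) z = Some (mulr1 mul b (odflt None z)) by case: z => [[]|].
by move=> x y; rewrite !E; split=> -[/ra ->].
Qed.

End AdjoinOne.

(** The root pair of the tree of [u] lies in the relation of [u] on that tree, hence also in that of
    [t]. *)
Lemma flrel_eval_hom (A : eqType) (t u : mterm A) (e := tedge (term_tree u)) :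
  meval (@fmul _ _ e) (@fplus _ _ e) (@fstar _ _ e) (@fone _ _ e) (@fvar _ _ e) t =
  meval (@fmul _ _ e) (@fplus _ _ e) (@fstar _ _ e) (@fone _ _ e) (@fvar _ _ e) u ->
  term_hom t u.
Proof.
by move=> tu; apply/sval_meval; rewrite tu; apply/sval_meval; apply: term_hom_refl.
Qed.

Lemma free_monoid_eqP (A : eqType) (F : Type) (mul : F -> F -> F) plus star one
    (iota : A -> F) (t u : mterm A) :
  is_free_adequate_monoid mul plus star one iota ->
  meval mul plus star one iota t = meval mul plus star one iota u <->
  term_hom t u /\ term_hom u t.
Proof.
move=> [adF _ freeF]; split=> [|[tu ut]]; last exact: (term_hom_sound iota adF tu ut).
suffices half (v w : mterm A) :
    meval mul plus star one iota v = meval mul plus star one iota w -> term_hom v w.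
  by move=> tu; split; apply: half.
move=> vw; have ad := flrel_adequate (bridged_unique (@bridged_term _ w)).
have [[h [hM [h1 hi]]] _] := freeF _ _ _ _ _ ad (@fvar _ _ _).
by apply: flrel_eval_hom; rewrite -!(meval_morph _ hM h1 hi) vw.
Qed.

(** One direction uses the injective morphism [some] into the monoid with adjoined identity. The
    other evaluates in the relation monoid, taken as an adequate semigroup. *)
Lemma free_semigroup_eqP (A : eqType) (F : Type) (mul : F -> F -> F) plus star
    (iota : A -> F) (t u : sterm A) :
  is_free_adequate_semigroup mul plus star iota ->
  seval mul plus star iota t = seval mul plus star iota u <->
  term_hom (mterm_of_sterm t) (mterm_of_sterm u) /\
  term_hom (mterm_of_sterm u) (mterm_of_sterm t).
Proof.
move=> [adF _ freeF]; split=> [|[tu ut]]; last first.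
  have sm : is_ad_morphism mul plus star (opt_mul mul) (omap plus) (omap star) some by split.
  have := term_hom_sound (Some \o iota) (adjoin_one_adequate adF) tu ut.
  by rewrite -!(seval_meval None _ sm (fun=> erefl)) => -[].
suffices half (v w : sterm A) : seval mul plus star iota v = seval mul plus star iota w ->
    term_hom (mterm_of_sterm v) (mterm_of_sterm w).
  by move=> tu; split; apply: half.
move=> vw; have ad := flrel_adequate (bridged_unique (@bridged_term _ (mterm_of_sterm w))).
have [[h [hM hi]] _] := freeF _ _ _ _ ad.1 (@fvar _ _ _).
by apply: flrel_eval_hom; rewrite -!(seval_meval (fone _) _ hM hi) vw.
Qed.

(** Rules are chosen by the shape of the body. The case of [drop] turns a parameter read inside a
    recursion back into a plain projection. *)
Ltac computable_step :=
  lazymatch goal with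
  | |- computable _ (fun _ => ?k) => apply: computable_const
  | |- computable _ (fun v => nth 0 v _) => by apply: computable_var
  | |- computable _ (fun v => nth 0 (drop _ v) _) =>
      apply: computable_ext => [v _|]; [rewrite nth_drop; reflexivity|]
  | |- computable _ (fun v => if @?f v == @?g v then _ else _) => apply: computable_eqn
  | |- computable _ (fun v => foldr _ _ (CodeSeq.decode (@?l v))) => apply: computable_foldr
  | |- computable _ (fun v => ccons _ _) => apply: (computable_app2 computable_ccons)
  | |- computable _ (fun v => chd _) => apply: (computable_app1 computable_chd)
  | |- computable _ (fun v => ctl _) => apply: (computable_app1 computable_ctl)
  end.

Ltac solve_computable := repeat computable_step.

(** * Trees and relations as numbers *)

(** An edge is coded as the nested pair of source, label and target; a tree as that of root, end and
    edge list. *)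
Definition code_map_edge (f : nat -> nat) (d : nat) : nat :=
  ccons (f (chd d)) (ccons (chd (ctl d)) (f (ctl (ctl d)))).

Definition code_tmul (g h : nat) : nat :=
  ccons (vleft (chd g)) (ccons (vjoin (chd (ctl g)) (chd h) (chd (ctl h)))
    (foldr (fun d r => ccons (code_map_edge vleft d) r)
       (foldr (fun d r => ccons (code_map_edge (vjoin (chd (ctl g)) (chd h)) d) r) 0
          (CodeSeq.decode (ctl (ctl h))))
       (CodeSeq.decode (ctl (ctl g))))).
Definition code_tplus (g : nat) : nat := ccons (chd g) (ccons (chd g) (ctl (ctl g))).
Definition code_tstar (g : nat) : nat :=
  ccons (chd (ctl g)) (ccons (chd (ctl g)) (ctl (ctl g))).
Definition code_tone : nat := ccons 0 (ccons 0 0).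
Definition code_tvar (a : nat) : nat := ccons 0 (ccons 1 (ccons (ccons 0 (ccons a 1)) 0)).

(** Relations are coded as lists of pairs [ccons x y], possibly with repetitions; only membership is
    used. *)
Definition code_rmul (r s : nat) : nat :=
  foldr (fun d m => foldr (fun d' m' =>
      if ctl d == chd d' then ccons (ccons (chd d) (ctl d')) m' else m') m (CodeSeq.decode s))
    0 (CodeSeq.decode r).
Definition code_rplus (r : nat) : nat :=
  foldr (fun d m => ccons (ccons (chd d) (chd d)) m) 0 (CodeSeq.decode r).
Definition code_rstar (r : nat) : nat :=
  foldr (fun d m => ccons (ccons (ctl d) (ctl d)) m) 0 (CodeSeq.decode r).
(** A finite list cannot hold the full diagonal of the natural numbers, so this is the diagonal on
    the root and the ends of edges. *)
Definition code_rone (g : nat) : nat :=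
  ccons (ccons (chd g) (chd g)) (foldr (fun d m =>
      ccons (ccons (chd d) (chd d)) (ccons (ccons (ctl (ctl d)) (ctl (ctl d))) m))
    0 (CodeSeq.decode (ctl (ctl g)))).
Definition code_rvar (g a : nat) : nat :=
  foldr (fun d m => if chd (ctl d) == a then ccons (ccons (chd d) (ctl (ctl d))) m else m)
    0 (CodeSeq.decode (ctl (ctl g))).

Definition code_mem (d c : nat) : nat :=
  foldr (fun d' m => if d' == d then 1 else m) 0 (CodeSeq.decode c).

Lemma computable_vleft : computable1 vleft.
Proof. by rewrite /computable1 /vleft; solve_computable. Qed.

Lemma computable_vjoin : computable3 vjoin.
Proof.
rewrite /computable3 /vjoin /vright; solve_computable.
exact: (computable_app1 computable_vleft (computable_var _)).
Qed.

Lemma computable_tmul : computable2 code_tmul.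
Proof.
rewrite /computable2 /code_tmul /code_map_edge; solve_computable.
all: first [apply: (computable_app1 computable_vleft) | apply: (computable_app3 computable_vjoin)].
all: solve_computable.
Qed.

Lemma computable_tplus : computable1 code_tplus.
Proof. by rewrite /computable1 /code_tplus; solve_computable. Qed.

Lemma computable_tstar : computable1 code_tstar.
Proof. by rewrite /computable1 /code_tstar; solve_computable. Qed.

Lemma computable_tvar : computable1 code_tvar.
Proof. by rewrite /computable1 /code_tvar; solve_computable. Qed.

Lemma computable_rmul : computable2 code_rmul.
Proof. by rewrite /computable2 /code_rmul; solve_computable. Qed.

Lemma computable_rplus : computable1 code_rplus.
Proof. by rewrite /computable1 /code_rplus; solve_computable. Qed.

Lemma computable_rstar : computable1 code_rstar.
Proof. by rewrite /computable1 /code_rstar; solve_computable. Qed.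

Lemma computable_rone : computable1 code_rone.
Proof. by rewrite /computable1 /code_rone; solve_computable. Qed.

Lemma computable_rvar : computable2 code_rvar.
Proof. by rewrite /computable2 /code_rvar; solve_computable. Qed.

Lemma computable_mem : computable2 code_mem.
Proof. by rewrite /computable2 /code_mem; solve_computable. Qed.

(** * Evaluation of coded terms by a stack machine *)

Section Coding.

Variable A : countType.

Let token : Type := (nat + A)%type.

(** A letter is represented by the token that stands for it in a coded term, so the machine passes
    tokens to [var] unchanged. *)
Definition label (a : A) : nat := pickle (inr a : token).

Lemma label_inj : injective label.
Proof. by move=> a b /(pcan_inj pickleK)[]. Qed.

(** In [GenTree.encode] a node labelled [k] is opened by [inl k.+1] and closed by [inl 0], whence
    the shift by one against [mterm_to]. *)
Definition op_token (k : nat) : nat := pickle (inl k : token).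

(* [pickle] is Polish notation, with the useless closing token [op_token 0], so
   that reading it from right to left is the run of a stack machine. *)
Definition stack_step (mul : nat -> nat -> nat) (plus star : nat -> nat) (one : nat)
    (var : nat -> nat) (tok st : nat) : nat :=
  if tok == op_token 0 then st else
  if tok == op_token 1 then ccons (mul (chd st) (chd (ctl st))) (ctl (ctl st)) else
  if tok == op_token 2 then ccons (plus (chd st)) (ctl st) else
  if tok == op_token 3 then ccons (star (chd st)) (ctl st) else
  if tok == op_token 4 then ccons one st else
  ccons (var tok) st.

Definition code_eval mul plus star one var (c : nat) : nat :=
  chd (foldr (stack_step mul plus star one var) 0 (CodeSeq.decode c)).

Lemma code_evalE mul plus star one var (t : mterm A) :
  code_eval mul plus star one var (pickle t) =
  meval mul plus star one (fun a => var (label a)) t.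
Proof.
have opE k l : (op_token k == op_token l) = (k == l).
  by apply/eqP/eqP => [/(pcan_inj pickleK)[]|->].
have labelE a l : (label a == op_token l) = false.
  by apply/eqP => /(pcan_inj pickleK).
rewrite /code_eval.
have -> : pickle t = CodeSeq.code (map pickle (GenTree.encode (mterm_to t))) by [].
rewrite CodeSeq.codeK.
set step := stack_step _ _ _ _ _.
(* Invariant of the machine: reading a term pushes its value and leaves the rest of the stack
   alone. *)
suffices run st : foldr step st (map pickle (GenTree.encode (mterm_to t))) =
    ccons (meval mul plus star one (fun a => var (label a)) t) st by rewrite run chd_ccons.
elim: t st => [a||t IHt u IHu|t IHt|t IHt] st /=.
- by rewrite -/(label a) /step /stack_step !labelE.
- by rewrite -/(op_token 4) -/(op_token 0) /step /stack_step !opE.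
- rewrite -/(op_token 1) map_rcons -cats1 map_cat map_cat !foldr_cat /= -/(op_token 0).
  have -> : step (op_token 0) st = st by rewrite /step /stack_step eqxx.
  by rewrite IHu IHt /step /stack_step !opE /= !(chd_ccons, ctl_ccons).
- rewrite -/(op_token 2) map_rcons -cats1 map_cat !foldr_cat /= -/(op_token 0).
  have -> : step (op_token 0) st = st by rewrite /step /stack_step eqxx.
  by rewrite IHt /step /stack_step !opE /= !(chd_ccons, ctl_ccons).
rewrite -/(op_token 3) map_rcons -cats1 map_cat !foldr_cat /= -/(op_token 0).
have -> : step (op_token 0) st = st by rewrite /step /stack_step eqxx.
by rewrite IHt /step /stack_step !opE /= !(chd_ccons, ctl_ccons).
Qed.

(** The parameter [p] is there for the code of the tree on which relations are computed; [one] and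
    [var] depend on it. *)
Lemma computable_eval mul plus star (one : nat -> nat) (var : nat -> nat -> nat) :
    computable2 mul -> computable1 plus -> computable1 star -> computable1 one ->
    computable2 var ->
  computable2 (fun p c => code_eval mul plus star (one p) (var p) c).
Proof.
move=> cmul cplus cstar cone cvar.
rewrite /computable2 /code_eval; apply: (computable_app1 computable_chd).
apply: computable_foldr; solve_computable; rewrite /stack_step; solve_computable.
- by apply: (computable_app2 cmul); solve_computable.
- by apply: (computable_app1 cplus); solve_computable.
- by apply: (computable_app1 cstar); solve_computable.
- by apply: (computable_app1 cone); solve_computable.
by apply: (computable_app2 cvar); solve_computable.
Qed.

(** * Correctness of the coded trees and relations *)

Definition code_edge (d : nat * A * nat) : nat := ccons d.1.1 (ccons (label d.1.2) d.2).

Definition code_tree (g : tree A) : nat :=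
  ccons (troot g) (ccons (tend g) (CodeSeq.code (map code_edge (tedges g)))).

Definition code_term_tree : nat -> nat :=
  code_eval code_tmul code_tplus code_tstar code_tone code_tvar.

Lemma foldr_map_edges f es z :
  foldr (fun d r => ccons (code_map_edge f d) r) z (map code_edge es) =
  CodeSeq.code (map code_edge (map_edges f es) ++ CodeSeq.decode z).
Proof.
elim: es => [|[[x a] y] es IHes] /=; first by rewrite CodeSeq.decodeK.
rewrite IHes /ccons CodeSeq.codeK /= /code_map_edge /code_edge /=.
by rewrite !(chd_ccons, ctl_ccons).
Qed.

Lemma code_term_treeE t : code_term_tree (pickle t) = code_tree (term_tree t).
Proof.
rewrite /code_term_tree code_evalE.
elim: t => [a||t IHt u IHu|t IHt|t IHt] //=.
- rewrite IHt IHu; set g := term_tree t; set h := term_tree u.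
  rewrite /code_tmul /code_tree !(chd_ccons, ctl_ccons) !CodeSeq.codeK !foldr_map_edges.
  by rewrite cats0 CodeSeq.codeK -map_cat.
- by rewrite IHt /code_tplus /code_tree !(chd_ccons, ctl_ccons).
by rewrite IHt /code_tstar /code_tree !(chd_ccons, ctl_ccons).
Qed.

Definition code_rel (g : nat) : nat -> nat :=
  code_eval code_rmul code_rplus code_rstar (code_rone g) (code_rvar g).

(** [trel] relates every number to itself under [MOne], while the coded relations list vertices of
    the tree only. By [trel_vertex] a bound on the first component bounds both. *)
Definition vertex (g : tree A) (x : nat) : Prop :=
  x = troot g \/ exists2 d, d \in tedges g & x = d.1.1 \/ x = d.2.

Lemma trel_vertex g t x y : trel (tedge g) t x y -> vertex g x <-> vertex g y.
Proof.
elim: t x y => [a||t IHt u IHu|t IHt|t IHt] x y /=.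
- by move=> xy; split=> _; right; exists (x, a, y) => //=; [right|left].
- by move->.
- by case=> z /IHt-> /IHu.
- by case=> ->.
by case=> ->.
Qed.

Lemma mem_foldr (F : nat -> nat -> nat) (P : nat -> nat -> bool) z l e :
    (forall d r, (e \in CodeSeq.decode (F d r)) = P d e || (e \in CodeSeq.decode r)) ->
  (e \in CodeSeq.decode (foldr F z l)) = has (P^~ e) l || (e \in CodeSeq.decode z).
Proof. by move=> FP; elim: l => //= d l IHl; rewrite FP IHl orbA. Qed.

Lemma mem_rmul e r s : (e \in CodeSeq.decode (code_rmul r s)) =
  has (fun d => has (fun d' => (ctl d == chd d') && (e == ccons (chd d) (ctl d')))
                 (CodeSeq.decode s)) (CodeSeq.decode r).
Proof.
rewrite /code_rmul -[RHS]orbF.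
apply: (mem_foldr (P := fun d e => has (fun d' => (ctl d == chd d') && (e == _)) _)) => d m.
apply: (mem_foldr (P := fun d' e => (ctl d == chd d') && (e == _))) => d' m'.
by case: eqP => //=; rewrite decode_ccons inE.
Qed.

Lemma mem_rplus e r : (e \in CodeSeq.decode (code_rplus r)) =
  has (fun d => e == ccons (chd d) (chd d)) (CodeSeq.decode r).
Proof.
rewrite /code_rplus -[RHS]orbF; apply: (mem_foldr (P := fun d e => e == _)) => d m.
by rewrite decode_ccons inE.
Qed.

Lemma mem_rstar e r : (e \in CodeSeq.decode (code_rstar r)) =
  has (fun d => e == ccons (ctl d) (ctl d)) (CodeSeq.decode r).
Proof.
rewrite /code_rstar -[RHS]orbF; apply: (mem_foldr (P := fun d e => e == _)) => d m.
by rewrite decode_ccons inE.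
Qed.

Lemma decode_edges g :
  CodeSeq.decode (ctl (ctl (code_tree g))) = map code_edge (tedges g).
Proof. by rewrite /code_tree !ctl_ccons CodeSeq.codeK. Qed.

Lemma mem_rone e g : (e \in CodeSeq.decode (code_rone (code_tree g))) =
  (e == ccons (troot g) (troot g)) ||
  has (fun d => (e == ccons d.1.1 d.1.1) || (e == ccons d.2 d.2)) (tedges g).
Proof.
rewrite /code_rone decode_ccons inE decode_edges /code_tree chd_ccons -[has _ _]orbF.
rewrite (mem_foldr (P := fun d e => (e == ccons (chd d) (chd d)) ||
                              (e == ccons (ctl (ctl d)) (ctl (ctl d))))) => [|d m].
  rewrite has_map; do 2![congr orb]; apply: eq_has => d /=.
  by rewrite /code_edge !(chd_ccons, ctl_ccons).
by rewrite !decode_ccons !inE orbA.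
Qed.

Lemma mem_rvar e g a : (e \in CodeSeq.decode (code_rvar (code_tree g) (label a))) =
  has (fun d => (d.1.2 == a) && (e == ccons d.1.1 d.2)) (tedges g).
Proof.
rewrite /code_rvar decode_edges -[RHS]orbF.
rewrite (mem_foldr (P := fun d e => (chd (ctl d) == label a) &&
                              (e == ccons (chd d) (ctl (ctl d))))) => [|d m].
  rewrite has_map; congr orb; apply: eq_has => d /=.
  by rewrite /code_edge !(chd_ccons, ctl_ccons) (inj_eq label_inj).
by case: eqP => //=; rewrite decode_ccons inE.
Qed.

Lemma mem_code_relP g t e :
  reflect (exists x y, [/\ e = ccons x y, vertex g x & trel (tedge g) t x y])
    (e \in CodeSeq.decode (code_rel (code_tree g) (pickle t))).
Proof.
rewrite /code_rel code_evalE.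
elim: t e => [a||t IHt u IHu|t IHt|t IHt] e /=.
- rewrite mem_rvar; apply: (iffP hasP) => [[[[x b] y] /= xy /andP[/eqP ba /eqP->]]|].
    by rewrite ba in xy; exists x, y; split; [|right; exists (x, a, y); [|left]|].
  by case=> x [y [-> _ xy]]; exists (x, a, y) => //=; rewrite !eqxx.
- rewrite mem_rone; apply: (iffP orP) => [[/eqP->|/hasP[d dg /orP[]/eqP->]]|].
  + by exists (troot g), (troot g); split=> //; left.
  + by exists d.1.1, d.1.1; split=> //; right; exists d => //; left.
  + by exists d.2, d.2; split=> //; right; exists d => //; right.
  case=> x [_ [-> [->|[d dg xd]] <-]]; first by left.
  by right; apply/hasP; exists d => //; case: xd => ->; rewrite eqxx ?orbT.
- rewrite mem_rmul; apply: (iffP hasP) => [[d /IHt[x [z [-> gx xz]]]]|].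
    rewrite chd_ccons ctl_ccons => /hasP[d' /IHu[z' [y [-> _ zy]]]].
    rewrite chd_ccons ctl_ccons => /andP[/eqP zz' /eqP->].
    by exists x, y; split=> //; exists z => //; rewrite zz'.
  case=> x [y [-> gx [z xz zy]]]; exists (ccons x z); first by apply/IHt; exists x, z.
  apply/hasP; exists (ccons z y).
    by apply/IHu; exists z, y; split=> //; apply/(trel_vertex xz).
  by rewrite !(chd_ccons, ctl_ccons) !eqxx.
- rewrite mem_rplus; apply: (iffP hasP) => [[d /IHt[x [z [-> gx xz]]]]|].
    by rewrite chd_ccons => /eqP->; exists x, x; split=> //; split=> //; exists z.
  case=> x [_ [-> gx [<- [z xz]]]]; exists (ccons x z); last by rewrite chd_ccons.
  by apply/IHt; exists x, z.
rewrite mem_rstar; apply: (iffP hasP) => [[d /IHt[z [x [-> gz zx]]]]|].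
  rewrite ctl_ccons => /eqP->; exists x, x; split=> //; first exact/(trel_vertex zx).
  by split=> //; exists z.
case=> x [_ [-> gx [<- [z zx]]]]; exists (ccons z x); last by rewrite ctl_ccons.
by apply/IHt; exists z, x; split=> //; apply/(trel_vertex zx).
Qed.

(** * The decision procedure *)

Definition code_hom (c d : nat) : nat :=
  code_mem (ccons (chd (code_term_tree d)) (chd (ctl (code_term_tree d))))
    (code_rel (code_term_tree d) c).

Lemma code_memE d c : code_mem d c = (d \in CodeSeq.decode c).
Proof.
rewrite /code_mem; elim: (CodeSeq.decode c) => //= e s ->.
by rewrite inE eq_sym; case: eqP.
Qed.

(** The root of the target is a vertex, so the restriction to vertices does not affect the pair that
    is tested. *)
Lemma code_homP (t u : mterm A) :
  exists b : bool, code_hom (pickle t) (pickle u) = b /\ (b <-> term_hom t u).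
Proof.
rewrite /code_hom code_memE code_term_treeE; set g := term_tree u.
exists (ccons (troot g) (tend g) \in CodeSeq.decode (code_rel (code_tree g) (pickle t))).
split; first by rewrite {1 2}/code_tree !(chd_ccons, ctl_ccons).
split=> [/mem_code_relP[x [y [/ccons_inj[<- <-] _]]]//|tu].
by apply/mem_code_relP; exists (troot g), (tend g); split=> //; left.
Qed.

Lemma computable_term_tree : computable1 code_term_tree.
Proof.
have cone : computable1 (fun=> code_tone) by apply: computable_const.
have cvar : computable2 (fun _ => code_tvar).
  by apply: (computable_app1 computable_tvar); solve_computable.
have ct := computable_eval computable_tmul computable_tplus computable_tstar cone cvar.
(* Building a tree depends on no other tree, so the parameter is filled with a dummy 0. *)
by apply: (computable_app2 ct (computable_const 1 0)); solve_computable.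
Qed.

Lemma computable_rel : computable2 code_rel.
Proof.
exact: (computable_eval computable_rmul computable_rplus computable_rstar
          computable_rone computable_rvar).
Qed.

Lemma computable_hom : computable2 code_hom.
Proof.
have ct := @computable_app1 _ 2 _ computable_term_tree (@computable_var 2 1 isT).
rewrite /computable2 /code_hom; apply: (computable_app2 computable_mem).
  by solve_computable.
by apply: (computable_app2 computable_rel); solve_computable.
Qed.

Lemma decidable_term_hom : exists c : recf, forall t u : mterm A,
  (term_hom t u /\ term_hom u t -> recf_eval c [:: pickle t; pickle u] 1) /\
  (~ (term_hom t u /\ term_hom u t) -> recf_eval c [:: pickle t; pickle u] 0).
Proof.
(* As [code_hom] is 0 or 1, this nested test computes the conjunction of the two directions. *)
have [c cP] : computable2 (fun c d => if code_hom c d == 1 then code_hom d c else 0).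
  rewrite /computable2; solve_computable.
    by apply: (computable_app2 computable_hom); solve_computable.
  by apply: (computable_app2 computable_hom); solve_computable.
exists c => t u; have /= := cP [:: pickle t; pickle u] erefl.
have [b [-> <-]] := code_homP t u; have [b' [-> <-]] := code_homP u t.
by case: b; case: b' => /= cE; split=> //; case.
Qed.

End Coding.

Theorem theorem7p1 :
  (forall (Sigma : finType) (F : Type) (mul : F -> F -> F) (plus star : F -> F)
          (iota : Sigma -> F),
      is_free_adequate_semigroup mul plus star iota ->
      decidable_rel (fun t u : sterm Sigma =>
                       seval mul plus star iota t = seval mul plus star iota u)) /\
  (forall (Sigma : finType) (F : Type) (mul : F -> F -> F) (plus star : F -> F)
          (one : F) (iota : Sigma -> F),
      is_free_adequate_monoid mul plus star one iota ->
      decidable_rel (fun t u : mterm Sigma =>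
                       meval mul plus star one iota t = meval mul plus star one iota u)).
Proof.
split=> [Sigma F mul plus star iota freeF|Sigma F mul plus star one iota freeF].
  have [c cP] := decidable_term_hom Sigma; exists c => t u.
  (* Both kinds of terms use the same node labels, so a semigroup term and its monoid image have the
     same code, and one program serves for both. *)
  have pickleE (v : sterm Sigma) : pickle v = pickle (mterm_of_sterm v).
    have -> : pickle v = pickle (sterm_to v) by [].
    have -> : pickle (mterm_of_sterm v) = pickle (mterm_to (mterm_of_sterm v)) by [].
    by congr pickle; elim: v => [a|v IHv w IHw|v IHv|v IHv] //=; rewrite ?IHv ?IHw.
  have [yes no] := cP (mterm_of_sterm t) (mterm_of_sterm u); rewrite !pickleE.
  by split=> [/(free_semigroup_eqP _ _ freeF)//|ntu]; apply: no => /(free_semigroup_eqP _ _ freeF).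
have [c cP] := decidable_term_hom Sigma; exists c => t u; have [yes no] := cP t u.
by split=> [/(free_monoid_eqP _ _ freeF)//|ntu]; apply: no => /(free_monoid_eqP _ _ freeF).
Qed.
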